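(* Let $\mathcal{V}$ be a cartesian monoidal category, $\mathcal{A}$ a closed symmetric monoidal abelian category, $\Sigma\colon\mathcal{V}\to\mathcal{A}$ a strong symmetric monoidal functor, and $X$ a $\mathcal{V}$-category. Then the magnitude cohomology ring $H^*_\Sigma(X)$ is graded commutative.
   Context: $\mathcal{V}$ cartesian means that its symmetric monoidal structure is given by categorical products, with terminal unit $1_{\mathcal{V}}$. Write $1_{\mathcal{A}}$ for the unit, $[-,-]$ for the internal hom, and $\tau$ for the braiding of $\mathcal{A}$; $\mathcal{A}$ is assumed to have the direct sums appearing below. Magnitude nerve: for a $\mathcal{V}$-category $X$, $B^\Sigma_\bullet(X)$ is the simplicial object of $\mathcal{A}$ with \[B^\Sigma_k(X)=\bigoplus_{x_0,\ldots,x_k}\Sigma X(x_0,x_1)\otimes\cdots\otimes\Sigma X(x_{k-1},x_k),\] the sum over all $(k+1)$-tuples of objects of $X$ (for $k=0$ each summand is $1_{\mathcal{A}}$). The inner face $d_i$ ($0<i<k$) maps the $(x_0,\ldots,x_k)$ summand to the $(x_0,\ldots,\widehat{x_i},\ldots,x_k)$ summand by $\Sigma X(x_{i-1},x_i)\otimes\Sigma X(x_i,x_{i+1})\cong\Sigma(X(x_{i-1},x_i)\otimes X(x_i,x_{i+1}))\to\Sigma X(x_{i-1},x_{i+1})$ induced by composition in $X$. The outer faces $d_0,d_k$ erase the first, respectively last, tensor factor via $\Sigma X(x_0,x_1)\to\Sigma 1_{\mathcal{V}}\cong 1_{\mathcal{A}}$, respectively $\Sigma X(x_{k-1},x_k)\to\Sigma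 1_{\mathcal{V}}\cong 1_{\mathcal{A}}$. The degeneracy $s_i$ inserts a factor $\Sigma X(x_i,x_i)$ via $1_{\mathcal{A}}\cong\Sigma 1_{\mathcal{V}}\to\Sigma X(x_i,x_i)$ induced by the identity of $x_i$. The magnitude chain complex is $C^\Sigma_k(X)=B^\Sigma_k(X)$ with $\partial=\sum_{i=0}^k(-1)^id_i$; the magnitude cochain complex is $C^k_\Sigma(X)=[C^\Sigma_k(X),1_{\mathcal{A}}]$ with $\partial^*=[\partial,1_{\mathcal{A}}]$; and $H^*_\Sigma(X)=H^*(C^*_\Sigma(X))$. The coproduct $\Delta\colon C^\Sigma_*(X)\to C^\Sigma_*(X)\otimes C^\Sigma_*(X)$ is the chain map given by the sum of the maps $C^\Sigma_{p+q}(X)\to C^\Sigma_p(X)\otimes C^\Sigma_q(X)$ sending the $(x_0,\ldots,x_{p+q})$ summand to the tensor product of the $(x_0,\ldots,x_p)$ and $(x_p,\ldots,x_{p+q})$ summands by the rebracketing isomorphism \[\Sigma X(x_0,x_1)\otimes\cdots\otimes\Sigma X(x_{p+q-1},x_{p+q})\to\bigl(\Sigma X(x_0,x_1)\otimes\cdots\otimes\Sigma X(x_{p-1},x_p)\bigr)\otimes\bigl(\Sigma X(x_p,x_{p+1})\otimes\cdots\otimes\Sigma X(x_{p+q-1},x_{p+q})\bigr).\] The product $\mu\colon C^*_\Sigma(X)\otimes C^*_\Sigma(X)\to C^*_\Sigma(X)$ is the dual $[\Delta,1_{\mathcal{A}}]$, precomposed with the canonical maps $[C^\Sigma_p(X),1_{\mathcal{A}}]\otimes[C^\Sigma_q(X),1_{\mathcal{A}}]\to[C^\Sigma_p(X)\otimes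 C^\Sigma_q(X),1_{\mathcal{A}}]$. It induces $\mu\colon H^p_\Sigma(X)\otimes H^q_\Sigma(X)\to H^{p+q}_\Sigma(X)$, making $H^*_\Sigma(X)$ an associative unital graded algebra in $\mathcal{A}$ (the unit is dual to the counit $\varepsilon\colon C^\Sigma_0(X)=\bigoplus_{x_0}1_{\mathcal{A}}\to 1_{\mathcal{A}}$ that is the identity on each summand). Graded commutative means that $\mu\circ\tau=(-1)^{pq}\mu$ as maps $H^p_\Sigma(X)\otimes H^q_\Sigma(X)\to H^{p+q}_\Sigma(X)$ for all $p,q$, where $\tau\colon H^p_\Sigma(X)\otimes H^q_\Sigma(X)\to H^q_\Sigma(X)\otimes H^p_\Sigma(X)$ is the braiding of $\mathcal{A}$. *)

(* Defs.v *)
From HB Require Import structures.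
From mathcomp Require Import all_boot all_algebra.
From mathcomp Require Import boolp.

Set Implicit Arguments.
Unset Strict Implicit.
Unset Printing Implicit Defensive.

Import GRing.Theory.
Local Open Scope ring_scope.

Declare Scope cat_scope.
Delimit Scope cat_scope with cat.
Local Open Scope cat_scope.

Record category := Category {
  ob :> Type;
  hom : ob -> ob -> Type;
  idm : forall a, hom a a;
  comp : forall a b c, hom b c -> hom a b -> hom a c;
  compA : forall a b c d (h : hom c d) (g : hom b c) (f : hom a b),
    comp h (comp g f) = comp (comp h g) f;
  comp1m : forall a b (f : hom a b), comp (idm b) f = f;
  compm1 : forall a b (f : hom a b), comp f (idm a) = f
}.

Arguments idm {_} _.
Notation "g ∘ f" := (comp g f) (at level 40, left associativity) : cat_scope.

Record iso (C : category) (a b : C) := Iso {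
  fwd :> hom a b;
  bwd : hom b a;
  fwdK : bwd ∘ fwd = idm a;
  bwdK : fwd ∘ bwd = idm b
}.

Record sym_monoidal (C : category) := SymMonoidal {
  tens : C -> C -> C;
  tensm : forall a a' b b', hom a a' -> hom b b' -> hom (tens a b) (tens a' b');
  munit : C;
  assoc : forall a b c, iso (tens (tens a b) c) (tens a (tens b c));
  lunit : forall a, iso (tens munit a) a;
  runit : forall a, iso (tens a munit) a;
  braid : forall a b, hom (tens a b) (tens b a);
  tensm1 : forall a b, tensm (idm a) (idm b) = idm (tens a b);
  tensmM : forall a a' a'' b b' b'' (g : hom a' a'') (f : hom a a')
      (g' : hom b' b'') (f' : hom b b'),
    tensm (g ∘ f) (g' ∘ f') = tensm g g' ∘ tensm f f';
  assocN : forall a a' b b' c c' (f : hom a a') (g : hom b b') (h : hom c c'),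
    assoc a' b' c' ∘ tensm (tensm f g) h = tensm f (tensm g h) ∘ assoc a b c;
  lunitN : forall a b (f : hom a b), lunit b ∘ tensm (idm munit) f = f ∘ lunit a;
  runitN : forall a b (f : hom a b), runit b ∘ tensm f (idm munit) = f ∘ runit a;
  braidN : forall a a' b b' (f : hom a a') (g : hom b b'),
    braid a' b' ∘ tensm f g = tensm g f ∘ braid a b;
  braidK : forall a b, braid b a ∘ braid a b = idm (tens a b);
  triangle : forall a b,
    tensm (idm a) (lunit b) ∘ assoc a munit b = tensm (runit a) (idm b);
  pentagon : forall a b c d,
    assoc a b (tens c d) ∘ assoc (tens a b) c d
    = tensm (idm a) (assoc b c d) ∘ assoc a (tens b c) d
      ∘ tensm (assoc a b c) (idm d);
  hexagon : forall a b c,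
    assoc b c a ∘ braid a (tens b c) ∘ assoc a b c
    = tensm (idm b) (braid a c) ∘ assoc b a c ∘ tensm (braid a b) (idm c)
}.

Arguments tensm {C} _ {a a' b b'} _ _.
Arguments munit {C} _.

(* The unit is terminal, and a ⊗ b with the projections a ⊗ b -> a ⊗ 1 ≅ a and
   a ⊗ b -> 1 ⊗ b ≅ b is a categorical product of a and b. *)
Record cartesian (V : category) (M : sym_monoidal V) := Cartesian {
  bang : forall a, hom a (munit M);
  bang_uniq : forall a (f : hom a (munit M)), f = bang a;
  cart_fst : forall a b, hom (tens M a b) a :=
    fun a b => runit M a ∘ tensm M (idm a) (bang b);
  cart_snd : forall a b, hom (tens M a b) b :=
    fun a b => lunit M b ∘ tensm M (bang a) (idm b);
  pairing : forall a b c, hom c a -> hom c b -> hom c (tens M a b);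
  cart_fst_pairing : forall a b c (f : hom c a) (g : hom c b),
    cart_fst a b ∘ pairing f g = f;
  cart_snd_pairing : forall a b c (f : hom c a) (g : hom c b),
    cart_snd a b ∘ pairing f g = g;
  pairing_uniq : forall a b c (u v : hom c (tens M a b)),
    cart_fst a b ∘ u = cart_fst a b ∘ v -> cart_snd a b ∘ u = cart_snd a b ∘ v -> u = v
}.

Record monoidal_closed (C : category) (M : sym_monoidal C) := MonoidalClosed {
  ihom : C -> C -> C;
  ev : forall b c, hom (tens M (ihom b c) b) c;
  curry : forall a b c, hom (tens M a b) c -> hom a (ihom b c);
  ev_curry : forall a b c (f : hom (tens M a b) c),
    ev b c ∘ tensm M (curry f) (idm b) = f;
  curry_uniq : forall a b c (u v : hom a (ihom b c)),
    ev b c ∘ tensm M u (idm b) = ev b c ∘ tensm M v (idm b) -> u = v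
}.

Record strong_sym_monoidal_functor (C D : category)
    (M : sym_monoidal C) (N : sym_monoidal D) := StrongSymMonoidalFunctor {
  fob :> C -> D;
  fmap : forall a b, hom a b -> hom (fob a) (fob b);
  fmap1 : forall a, fmap (idm a) = idm (fob a);
  fmapM : forall a b c (g : hom b c) (f : hom a b),
    fmap (g ∘ f) = fmap g ∘ fmap f;
  phi : forall a b, iso (tens N (fob a) (fob b)) (fob (tens M a b));
  phi0 : iso (munit N) (fob (munit M));
  phiN : forall a a' b b' (f : hom a a') (g : hom b b'),
    fmap (tensm M f g) ∘ phi a b = phi a' b' ∘ tensm N (fmap f) (fmap g);
  phi_assoc : forall a b c,
    fmap (assoc M a b c) ∘ phi (tens M a b) c
      ∘ tensm N (phi a b) (idm (fob c))
    = phi a (tens M b c) ∘ tensm N (idm (fob a)) (phi b c)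
      ∘ assoc N (fob a) (fob b) (fob c);
  phi_lunit : forall a,
    fmap (lunit M a) ∘ phi (munit M) a ∘ tensm N phi0 (idm (fob a))
    = lunit N (fob a);
  phi_runit : forall a,
    fmap (runit M a) ∘ phi a (munit M) ∘ tensm N (idm (fob a)) phi0
    = runit N (fob a);
  phi_braid : forall a b,
    fmap (braid M a b) ∘ phi a b = phi b a ∘ braid N (fob a) (fob b)
}.

Record enriched_category (V : category) (M : sym_monoidal V) :=
  EnrichedCategory {
  eob :> Type;
  ehom : eob -> eob -> V;
  eid : forall x, hom (munit M) (ehom x x);
  ecomp : forall x y z, hom (tens M (ehom x y) (ehom y z)) (ehom x z);
  ecompA : forall x y z w,
    ecomp x z w ∘ tensm M (ecomp x y z) (idm (ehom z w))
    = ecomp x y w ∘ tensm M (idm (ehom x y)) (ecomp y z w)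
      ∘ assoc M (ehom x y) (ehom y z) (ehom z w);
  ecomp1m : forall x y,
    ecomp x x y ∘ tensm M (eid x) (idm (ehom x y)) = lunit M (ehom x y);
  ecompm1 : forall x y,
    ecomp x y y ∘ tensm M (idm (ehom x y)) (eid y) = runit M (ehom x y)
}.

Record preadditive := Preadditive {
  pre_cat :> category;
  hadd : forall a b : pre_cat, hom a b -> hom a b -> hom a b;
  hzero : forall a b : pre_cat, hom a b;
  hopp : forall a b : pre_cat, hom a b -> hom a b;
  haddA : forall a b, associative (@hadd a b);
  haddC : forall a b, commutative (@hadd a b);
  hadd0 : forall a b, left_id (hzero a b) (@hadd a b);
  haddN : forall a b, left_inverse (hzero a b) (@hopp a b) (@hadd a b);
  hcompDl : forall a b c (g g' : hom b c) (f : hom a b),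
    hadd g g' ∘ f = hadd (g ∘ f) (g' ∘ f);
  hcompDr : forall a b c (g : hom b c) (f f' : hom a b),
    g ∘ hadd f f' = hadd (g ∘ f) (g ∘ f')
}.

(* Each hom-set becomes a zmodType; its eqType and choiceType structures are
   the classical ones, so they put no condition on the category. *)
HB.instance Definition _ (A : preadditive) (a b : A) :=
  gen_eqMixin (@hom (pre_cat A) a b).
HB.instance Definition _ (A : preadditive) (a b : A) :=
  gen_choiceMixin (@hom (pre_cat A) a b).
HB.instance Definition _ (A : preadditive) (a b : A) :=
  GRing.isZmodule.Build (@hom (pre_cat A) a b)
    (@haddA A a b) (@haddC A a b) (@hadd0 A a b) (@haddN A a b).

Definition monic (C : category) (a b : C) (m : hom a b) :=
  forall c (u v : hom c a), m ∘ u = m ∘ v -> u = v.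

Definition epic (C : category) (a b : C) (e : hom a b) :=
  forall c (u v : hom b c), u ∘ e = v ∘ e -> u = v.

Record kernel (A : preadditive) (a b : A) (f : hom a b) := Kernel {
  ker :> A;
  kermap : hom ker a;
  comp_kermap : f ∘ kermap = 0;
  kerlift : forall c (g : hom c a), f ∘ g = 0 -> hom c ker;
  kermap_lift : forall c (g : hom c a) (fg0 : f ∘ g = 0),
    kermap ∘ kerlift fg0 = g;
  kermap_monic : monic kermap
}.

Record cokernel (A : preadditive) (a b : A) (f : hom a b) := Cokernel {
  coker :> A;
  cokermap : hom b coker;
  comp_cokermap : cokermap ∘ f = 0;
  cokerdesc : forall c (g : hom b c), g ∘ f = 0 -> hom coker c;
  cokerdesc_map : forall c (g : hom b c) (gf0 : g ∘ f = 0),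
    cokerdesc gf0 ∘ cokermap = g;
  cokermap_epic : epic cokermap
}.

Record biproduct (A : preadditive) (a b : A) := Biproduct {
  bip :> A;
  binl : hom a bip;
  binr : hom b bip;
  prl : hom bip a;
  prr : hom bip b;
  prl_inl : prl ∘ binl = idm a;
  prr_inr : prr ∘ binr = idm b;
  prl_inr : prl ∘ binr = 0;
  prr_inl : prr ∘ binl = 0;
  bip_id : binl ∘ prl + binr ∘ prr = idm bip
}.

Record abelian_category := AbelianCategory {
  ab_pre :> preadditive;
  zob : ab_pre;
  zob_id : idm zob = 0;
  ab_biprod : forall a b : ab_pre, biproduct a b;
  ab_ker : forall (a b : ab_pre) (f : hom a b), kernel f;
  ab_coker : forall (a b : ab_pre) (f : hom a b), cokernel f;
  ab_mono_normal : forall (a b : ab_pre) (m : hom a b), monic m ->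
    exists (c : ab_pre) (f : hom b c) (K : kernel f) (i : iso a K),
      m = kermap K ∘ i;
  ab_epi_normal : forall (a b : ab_pre) (e : hom a b), epic e ->
    exists (c : ab_pre) (f : hom c a) (Q : cokernel f) (i : iso Q b),
      e = i ∘ cokermap Q
}.

Record coproduct (C : category) (I : Type) (F : I -> C) := Coproduct {
  coprod :> C;
  inj : forall i, hom (F i) coprod;
  copair : forall c, (forall i, hom (F i) c) -> hom coprod c;
  copair_inj : forall c (g : forall i, hom (F i) c) i, copair g ∘ inj i = g i;
  copair_uniq : forall c (u v : hom coprod c),
    (forall i, u ∘ inj i = v ∘ inj i) -> u = v
}.

Section Additivity.
Variable A : preadditive.
Implicit Types a b c : A.

Lemma compDr a b c (g : hom b c) (f f' : hom a b) :
  g ∘ (f + f') = g ∘ f + g ∘ f'.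
Proof. exact: hcompDr. Qed.
Lemma compDl a b c (g g' : hom b c) (f : hom a b) :
  (g + g') ∘ f = g ∘ f + g' ∘ f.
Proof. exact: hcompDl. Qed.

Definition postcomp a b c (g : hom b c) (f : hom a b) := g ∘ f.
Definition precomp a b c (f : hom a b) (g : hom b c) := g ∘ f.

Fact postcomp_is_zmod_morphism a b c (g : hom b c) :
  zmod_morphism (@postcomp a b c g).
Proof.
by move=> f f'; apply: (addIr (g ∘ f')); rewrite /postcomp -compDr !subrK.
Qed.
Fact precomp_is_zmod_morphism a b c (f : hom a b) :
  zmod_morphism (@precomp a b c f).
Proof.
by move=> g g'; apply: (addIr (g' ∘ f)); rewrite /precomp -compDl !subrK.
Qed.

HB.instance Definition _ a b c (g : hom b c) :=
  GRing.isZmodMorphism.Build (hom a b) (hom a c) (@postcomp a b c g)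
    (postcomp_is_zmod_morphism g).
HB.instance Definition _ a b c (f : hom a b) :=
  GRing.isZmodMorphism.Build (hom b c) (hom a c) (@precomp a b c f)
    (precomp_is_zmod_morphism f).

Lemma comp0r a b c (g : hom b c) : g ∘ (0 : hom a b) = 0.
Proof. exact: (raddf0 (@postcomp a b c g)). Qed.
Lemma comp0l a b c (f : hom a b) : (0 : hom b c) ∘ f = 0.
Proof. exact: (raddf0 (@precomp a b c f)). Qed.
Lemma compzr a b c (g : hom b c) (f : hom a b) n : g ∘ (f *~ n) = (g ∘ f) *~ n.
Proof. exact: (raddfMz (@postcomp a b c g)). Qed.
Lemma compzl a b c (g : hom b c) (f : hom a b) n : (g *~ n) ∘ f = (g ∘ f) *~ n.
Proof. exact: (raddfMz (@precomp a b c f)). Qed.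
Lemma comp_sumr a b c (g : hom b c) I (r : seq I) P (F : I -> hom a b) :
  g ∘ (\sum_(i <- r | P i) F i) = \sum_(i <- r | P i) (g ∘ F i).
Proof. exact: (raddf_sum (@postcomp a b c g)). Qed.
Lemma comp_suml a b c (f : hom a b) I (r : seq I) P (G : I -> hom b c) :
  (\sum_(i <- r | P i) G i) ∘ f = \sum_(i <- r | P i) (G i ∘ f).
Proof. exact: (raddf_sum (@precomp a b c f)). Qed.

End Additivity.

Section Monoidal.
Variables (C : category) (M : sym_monoidal C).
Implicit Types a b c d : C.
Local Notation "a ⊗ b" := (tens M a b) (at level 35, right associativity).
Local Notation "f ⊠ g" := (tensm M f g) (at level 35, right associativity).
Local Notation id := idm.

Lemma iso_monic a b (i : iso a b) c (u v : hom c a) : i ∘ u = i ∘ v -> u = v.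
Proof. by move=> e; rewrite -(comp1m u) -(comp1m v) -(fwdK i) -!compA e. Qed.
Lemma iso_epic a b (i : iso a b) c (u v : hom b c) : u ∘ i = v ∘ i -> u = v.
Proof. by move=> e; rewrite -(compm1 u) -(compm1 v) -(bwdK i) !compA e. Qed.
Lemma bwd_epic a b (i : iso a b) c (u v : hom a c) :
  u ∘ bwd i = v ∘ bwd i -> u = v.
Proof. by move=> e; rewrite -(compm1 u) -(compm1 v) -(fwdK i) !compA e. Qed.

Lemma tensm_l a a' b b' (f : hom a a') (g : hom b b') :
  f ⊠ g = (f ⊠ id b') ∘ (id a ⊠ g).
Proof. by rewrite -tensmM compm1 comp1m. Qed.
Lemma tensm_r a a' b b' (f : hom a a') (g : hom b b') :
  f ⊠ g = (id a' ⊠ g) ∘ (f ⊠ id b).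
Proof. by rewrite -tensmM compm1 comp1m. Qed.
Lemma tensmMl a a' a'' b (g : hom a' a'') (f : hom a a') :
  (g ∘ f) ⊠ id b = (g ⊠ id b) ∘ (f ⊠ id b).
Proof. by rewrite -tensmM comp1m. Qed.
Lemma tensmMr a b b' b'' (g : hom b' b'') (f : hom b b') :
  id a ⊠ (g ∘ f) = (id a ⊠ g) ∘ (id a ⊠ f).
Proof. by rewrite -tensmM comp1m. Qed.

Lemma assocNV a a' b b' c c' (f : hom a a') (g : hom b b') (h : hom c c') :
  bwd (assoc M a' b' c') ∘ (f ⊠ (g ⊠ h))
  = ((f ⊠ g) ⊠ h) ∘ bwd (assoc M a b c).
Proof.
apply: (iso_monic (i := assoc M a' b' c')).
by rewrite !compA bwdK comp1m assocN -compA bwdK compm1.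
Qed.
Lemma lunitNV a b (f : hom a b) :
  bwd (lunit M b) ∘ f = (id (munit M) ⊠ f) ∘ bwd (lunit M a).
Proof.
apply: (iso_monic (i := lunit M b)).
by rewrite !compA bwdK comp1m lunitN -compA bwdK compm1.
Qed.

Lemma unit_tens_inj a b (u v : hom a b) :
  id (munit M) ⊠ u = id (munit M) ⊠ v -> u = v.
Proof.
move=> e; apply: (iso_epic (i := lunit M a)).
by rewrite -!lunitN e.
Qed.
Lemma tens_unit_inj a b (u v : hom a b) :
  u ⊠ id (munit M) = v ⊠ id (munit M) -> u = v.
Proof.
move=> e; apply: (iso_epic (i := runit M a)).
by rewrite -!runitN e.
Qed.

Lemma lunit_tens a b :
  lunit M (a ⊗ b) ∘ assoc M (munit M) a b = lunit M a ⊠ id b.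
Proof.
apply: unit_tens_inj; rewrite tensmMr.
apply: (iso_epic (i := assoc M (munit M) (munit M ⊗ a) b)).
pose al := assoc M (munit M) (munit M) a.
have ep : forall c (u v : hom ((munit M ⊗ (munit M ⊗ a)) ⊗ b) c),
    u ∘ (al ⊠ id b) = v ∘ (al ⊠ id b) -> u = v.
  move=> c u v e.
  rewrite -(compm1 u) -(compm1 v) -tensm1 -(bwdK al) tensmMl !compA.
  by rewrite e.
apply: ep.
rewrite -!compA (compA _ (assoc M _ (munit M ⊗ a) b)) -pentagon.
rewrite !compA triangle -(tensm1 M a b) -assocN.
rewrite -assocN.
by rewrite -!compA -tensmMl triangle.
Qed.

Lemma lunit_tensV a b :
  (lunit M a ⊠ id b) ∘ bwd (assoc M (munit M) a b) = lunit M (a ⊗ b).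
Proof. by rewrite -lunit_tens -compA bwdK compm1. Qed.

Lemma lunit_lunit a :
  lunit M (munit M ⊗ a) = id (munit M) ⊠ lunit M a :> hom _ _.
Proof.
apply: (iso_monic (i := lunit M a)).
by rewrite lunitN.
Qed.

Lemma lunit_unit : lunit M (munit M) = runit M (munit M) :> hom _ _.
Proof.
apply: tens_unit_inj.
by rewrite -triangle -lunit_tens lunit_lunit.
Qed.

Lemma triangleV a b :
  bwd (assoc M a (munit M) b) ∘ (id a ⊠ bwd (lunit M b))
  = bwd (runit M a) ⊠ id b.
Proof.
apply: (iso_monic (i := assoc M a (munit M) b)).
rewrite compA bwdK comp1m.
have e : (id a ⊠ lunit M b) ∘ (assoc M a (munit M) b ∘ (bwd (runit M a) ⊠ id b))
   = id _ by rewrite compA triangle -tensmMl bwdK tensm1.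
rewrite -[RHS]comp1m -tensm1 -(fwdK (lunit M b)) tensmMr -compA e.
by rewrite compm1.
Qed.

Lemma pentagonV a b c d :
  bwd (assoc M (a ⊗ b) c d) ∘ bwd (assoc M a b (c ⊗ d))
  = (bwd (assoc M a b c) ⊠ id d) ∘ bwd (assoc M a (b ⊗ c) d)
    ∘ (id a ⊠ bwd (assoc M b c d)).
Proof.
apply: (iso_epic (i := assoc M a b (c ⊗ d))).
apply: (iso_epic (i := assoc M (a ⊗ b) c d)).
rewrite -(compA _ _ (fwd (assoc M a b (c ⊗ d)))) fwdK compm1 fwdK.
rewrite -!compA pentagon.
rewrite (compA (id a ⊠ bwd _)) (compA (id a ⊠ bwd _)) -tensmMr fwdK tensm1 comp1m.
by rewrite (compA (bwd (assoc M a (b ⊗ c) d))) fwdK comp1m -tensmMl fwdK tensm1.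
Qed.

Lemma assoc_interchange s s' s'' t f b (c : hom (s ⊗ s') s'')
    (r : hom t (f ⊗ b)) :
  bwd (assoc M s'' f b) ∘ (id s'' ⊠ r) ∘ ((c ⊠ id t) ∘ bwd (assoc M s s' t))
  = (((c ⊠ id f) ∘ bwd (assoc M s s' f)) ⊠ id b)
    ∘ (bwd (assoc M s (s' ⊗ f) b)
       ∘ (id s ⊠ (bwd (assoc M s' f b) ∘ (id s' ⊠ r)))).
Proof.
rewrite compA -(compA (bwd _) (id s'' ⊠ r)) -tensm_r tensm_l compA.
rewrite -(tensm1 M f b) assocNV -!compA -tensm1 -assocNV.
by rewrite tensmMl tensmMr -!compA !(compA _ _ (id s ⊠ (id s' ⊠ r))) pentagonV
  -!compA.
Qed.

Lemma erase_interchange s t f b (e : hom s (munit M)) (r : hom t (f ⊗ b)) :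
  r ∘ (lunit M t ∘ (e ⊠ id t))
  = ((lunit M f ∘ (e ⊠ id f)) ⊠ id b) ∘ (bwd (assoc M s f b) ∘ (id s ⊠ r)).
Proof.
rewrite tensmMl -!compA (compA ((e ⊠ id f) ⊠ id b)) -assocNV tensm1.
rewrite !compA lunit_tensV -lunitN -!compA -tensm_r -tensm_l //.
Qed.

Lemma assoc_stepl s t f f' b (g : hom f f') (r : hom t (f ⊗ b)) :
  bwd (assoc M s f' b) ∘ (id s ⊠ ((g ⊠ id b) ∘ r))
  = ((id s ⊠ g) ⊠ id b) ∘ (bwd (assoc M s f b) ∘ (id s ⊠ r)).
Proof. by rewrite tensmMr !compA assocNV. Qed.

Lemma assoc_stepr s t t' f b b' (g : hom b b') (r : hom t (f ⊗ b))
    (h : hom t' t) :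
  bwd (assoc M s f b') ∘ (id s ⊠ ((id f ⊠ g) ∘ r ∘ h))
  = (id (s ⊗ f) ⊠ g) ∘ (bwd (assoc M s f b) ∘ (id s ⊠ r)) ∘ (id s ⊠ h).
Proof. by rewrite 2!tensmMr !compA assocNV tensm1. Qed.

End Monoidal.

Section Closed.
Variables (A : abelian_category) (M : sym_monoidal A) (cl : monoidal_closed M).
Implicit Types a b c d : A.
Local Notation "a ⊗ b" := (tens M a b) (at level 35, right associativity).
Local Notation "f ⊠ g" := (tensm M f g) (at level 35, right associativity).
Local Notation id := idm.

Lemma curryK a b c (f : hom (a ⊗ b) c) : ev cl b c ∘ (curry cl f ⊠ id b) = f.
Proof. exact: ev_curry. Qed.

Lemma curry_comp a a' b c (f : hom (a' ⊗ b) c) (g : hom a a') :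
  curry cl f ∘ g = curry cl (f ∘ (g ⊠ id b)).
Proof. by apply: (curry_uniq (m := cl)); rewrite tensmMl compA !curryK. Qed.

Lemma curry_inj a b c (f g : hom (a ⊗ b) c) : curry cl f = curry cl g -> f = g.
Proof. by move=> e; rewrite -(curryK f) -(curryK g) e. Qed.

Lemma zob_to (a : A) (f g : hom (zob A) a) : f = g.
Proof. by rewrite -(compm1 f) -(compm1 g) zob_id !comp0r. Qed.

Lemma tens_zob b : id (zob A ⊗ b) = 0.
Proof. by apply: curry_inj; apply: zob_to. Qed.

Lemma tensm0l a a' b : (0 : hom a a') ⊠ id b = 0.
Proof.
have -> : 0 = (0 : hom (zob A) a') ∘ (0 : hom a (zob A)) by rewrite comp0r.
by rewrite tensmMl -[X in _ ∘ X]comp1m tens_zob comp0l comp0r.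
Qed.

Lemma tens_inlr_epic a b c d (P : biproduct a b) (u v : hom (P ⊗ c) d) :
  u ∘ (binl P ⊠ id c) = v ∘ (binl P ⊠ id c) ->
  u ∘ (binr P ⊠ id c) = v ∘ (binr P ⊠ id c) -> u = v.
Proof.
move=> el er; apply: curry_inj.
rewrite -[LHS]compm1 -[RHS]compm1 -(bip_id P) !compDr !compA.
by rewrite !curry_comp el er.
Qed.

Lemma tensmDl a a' b (f g : hom a a') : (f + g) ⊠ id b = f ⊠ id b + g ⊠ id b.
Proof.
pose P := ab_biprod a' a'.
pose n : hom P a' := prl P + prr P.
pose h : hom a P := binl P ∘ f + binr P ∘ g.
have nl : n ∘ binl P = id a' by rewrite compDl prl_inl prr_inl addr0.
have nr : n ∘ binr P = id a' by rewrite compDl prl_inr prr_inr add0r.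
have hl : prl P ∘ h = f.
  by rewrite compDr !compA prl_inl prl_inr comp0l addr0 comp1m.
have hr : prr P ∘ h = g.
  by rewrite compDr !compA prr_inl prr_inr comp0l add0r comp1m.
have e : (binl P ⊠ id b) ∘ (prl P ⊠ id b) + (binr P ⊠ id b) ∘ (prr P ⊠ id b)
    = id (P ⊗ b).
  apply: (tens_inlr_epic (P := P)).
    rewrite compDl comp1m -!compA -!tensmMl prl_inl prr_inl.
    by rewrite compm1 comp0r tensm0l addr0.
  rewrite compDl comp1m -!compA -!tensmMl prl_inr prr_inr.
  by rewrite compm1 comp0r tensm0l add0r.
have -> : f + g = n ∘ h by rewrite compDr !compA nl nr !comp1m.
rewrite tensmMl -[h ⊠ _]comp1m -e compDl compDr.
by rewrite -!compA -!tensmMl hl hr !compA nl nr !comp1m.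
Qed.

Lemma tensm_braid a a' b b' (f : hom a a') (g : hom b b') :
  f ⊠ g = braid M b' a' ∘ (g ⊠ f) ∘ braid M a b.
Proof. by rewrite braidN -compA braidK compm1. Qed.

Lemma tensmDr a b b' (f g : hom b b') : id a ⊠ (f + g) = id a ⊠ f + id a ⊠ g.
Proof.
by rewrite 3!(tensm_braid (id a)) tensmDl compDr compDl.
Qed.

Definition tensml a a' b (f : hom a a') := f ⊠ id b.
Definition tensmr a b b' (f : hom b b') := id a ⊠ f.

Fact tensml_is_zmod_morphism a a' b : zmod_morphism (@tensml a a' b).
Proof.
by move=> f f'; apply: (addIr (f' ⊠ id b)); rewrite /tensml -tensmDl !subrK.
Qed.
Fact tensmr_is_zmod_morphism a b b' : zmod_morphism (@tensmr a b b').
Proof.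
by move=> f f'; apply: (addIr (id a ⊠ f')); rewrite /tensmr -tensmDr !subrK.
Qed.

HB.instance Definition _ a a' b :=
  GRing.isZmodMorphism.Build (hom a a') (hom (a ⊗ b) (a' ⊗ b))
    (@tensml a a' b) (@tensml_is_zmod_morphism a a' b).
HB.instance Definition _ a b b' :=
  GRing.isZmodMorphism.Build (hom b b') (hom (a ⊗ b) (a ⊗ b'))
    (@tensmr a b b') (@tensmr_is_zmod_morphism a b b').

Lemma tensm0r a b b' : id a ⊠ (0 : hom b b') = 0.
Proof. exact: (raddf0 (@tensmr a b b')). Qed.
Lemma tensmzl a a' b (f : hom a a') n : (f *~ n) ⊠ id b = (f ⊠ id b) *~ n.
Proof. exact: (raddfMz (@tensml a a' b)). Qed.
Lemma tensmzr a b b' (f : hom b b') n : id a ⊠ (f *~ n) = (id a ⊠ f) *~ n.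
Proof. exact: (raddfMz (@tensmr a b b')). Qed.
Lemma tensm_suml a a' b I (r : seq I) P (F : I -> hom a a') :
  (\sum_(i <- r | P i) F i) ⊠ id b = \sum_(i <- r | P i) (F i ⊠ id b).
Proof. exact: (raddf_sum (@tensml a a' b)). Qed.
Lemma tensm_sumr a b b' I (r : seq I) P (F : I -> hom b b') :
  id a ⊠ (\sum_(i <- r | P i) F i) = \sum_(i <- r | P i) (id a ⊠ F i).
Proof. exact: (raddf_sum (@tensmr a b b')). Qed.

Definition ihom_map d a b (f : hom a b) : hom (ihom cl b d) (ihom cl a d) :=
  curry cl (ev cl b d ∘ (id (ihom cl b d) ⊠ f)).

Lemma ev_ihom_map d a b (f : hom a b) :
  ev cl a d ∘ (ihom_map d f ⊠ id a) = ev cl b d ∘ (id (ihom cl b d) ⊠ f).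
Proof. exact: curryK. Qed.

Lemma ihom_mapM d a b c (g : hom b c) (f : hom a b) :
  ihom_map d (g ∘ f) = ihom_map d f ∘ ihom_map d g.
Proof.
apply: (curry_uniq (m := cl)); rewrite ev_ihom_map tensmMl compA ev_ihom_map.
rewrite -[in RHS]compA -tensm_r (tensm_l M (ihom_map d g) f) [in RHS]compA.
by rewrite ev_ihom_map -compA -tensmMr.
Qed.

Lemma ihom_mapD d a b (f g : hom a b) :
  ihom_map d (f + g) = ihom_map d f + ihom_map d g.
Proof.
apply: (curry_uniq (m := cl)).
by rewrite tensmDl compDr !ev_ihom_map tensmDr compDr.
Qed.

Fact ihom_map_is_zmod_morphism d a b : zmod_morphism (@ihom_map d a b).
Proof.
by move=> f f'; apply: (addIr (ihom_map d f')); rewrite -ihom_mapD !subrK.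
Qed.

HB.instance Definition _ d a b :=
  GRing.isZmodMorphism.Build (hom a b) (hom (ihom cl b d) (ihom cl a d))
    (@ihom_map d a b) (@ihom_map_is_zmod_morphism d a b).

Definition dual a : A := ihom cl a (munit M).
Definition dual_map a b (f : hom a b) : hom (dual b) (dual a) :=
  ihom_map (munit M) f.

Lemma ev_dual_map a b (f : hom a b) :
  ev cl a (munit M) ∘ (dual_map f ⊠ id a) = ev cl b (munit M) ∘ (id (dual b) ⊠ f).
Proof. exact: ev_ihom_map. Qed.

Definition interchange a b c d : hom ((a ⊗ b) ⊗ (c ⊗ d)) ((a ⊗ c) ⊗ (b ⊗ d)) :=
  bwd (assoc M a c (b ⊗ d))
  ∘ (id a ⊠ (assoc M c b d ∘ (braid M b c ⊠ id d) ∘ bwd (assoc M b c d)))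
  ∘ assoc M a b (c ⊗ d).

(* The canonical map [a, 1] ⊗ [b, 1] -> [a ⊗ b, 1]. *)
Definition dual_tens a b : hom (dual a ⊗ dual b) (dual (a ⊗ b)) :=
  curry cl (lunit M (munit M) ∘ (ev cl a (munit M) ⊠ ev cl b (munit M))
            ∘ interchange (dual a) (dual b) a b).

Lemma interchangeN a a' b b' c c' d d' (f : hom a a') (g : hom b b')
    (h : hom c c') (k : hom d d') :
  interchange a' b' c' d' ∘ ((f ⊠ g) ⊠ (h ⊠ k))
  = ((f ⊠ h) ⊠ (g ⊠ k)) ∘ interchange a b c d.
Proof.
rewrite /interchange -!compA assocN !compA; congr (_ ∘ _).
rewrite -assocNV -!(compA (bwd (assoc M a' c' (b' ⊗ d')))); congr (_ ∘ _).
rewrite -!tensmM comp1m compm1; congr (_ ⊠ _).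
rewrite -!compA assocNV !compA; congr (_ ∘ _).
rewrite -assocN -!compA; congr (_ ∘ _).
by rewrite -!tensmM braidN comp1m compm1.
Qed.

Lemma dual_tensN a a' b b' (f : hom a a') (g : hom b b') :
  dual_map (f ⊠ g) ∘ dual_tens a' b'
  = dual_tens a b ∘ (dual_map f ⊠ dual_map g).
Proof.
rewrite [RHS]curry_comp; apply: (curry_uniq (m := cl)); rewrite [RHS]curryK.
rewrite tensmMl compA ev_ihom_map -[LHS]compA -tensm_r.
rewrite (tensm_l M (dual_tens a' b')) [LHS]compA curryK.
rewrite -[LHS]compA -(tensm1 M (dual a') (dual b')) interchangeN.
rewrite -(tensm1 M a b) -[RHS]compA interchangeN [LHS]compA [RHS]compA.
by rewrite -[in LHS](compA (lunit M _)) -[in RHS](compA (lunit M _)) -!tensmM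
  !ev_dual_map.
Qed.

(* As - ⊗ w is a left adjoint, a map out of b ⊗ w descends along
   b ⊗ w -> coker f ⊗ w as soon as it vanishes on the image of f ⊗ w. *)
Section Descent.
Variables (a b w c : A) (f : hom a b) (Q : cokernel f).

Fact desc_tensl_subproof (g : hom (b ⊗ w) c) :
  g ∘ (f ⊠ id w) = 0 -> curry cl g ∘ f = 0.
Proof.
move=> e; rewrite curry_comp e; apply: (curry_uniq (m := cl)).
by rewrite curryK tensm0l comp0r.
Qed.

Definition desc_tensl (g : hom (b ⊗ w) c) (gf0 : g ∘ (f ⊠ id w) = 0) :
    hom (Q ⊗ w) c :=
  ev cl w c ∘ (cokerdesc Q (desc_tensl_subproof gf0) ⊠ id w).

Lemma desc_tenslE g gf0 : @desc_tensl g gf0 ∘ (cokermap Q ⊠ id w) = g.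
Proof. by rewrite -compA -tensmMl cokerdesc_map curryK. Qed.

Fact desc_tensr_subproof (g : hom (w ⊗ b) c) :
  g ∘ (id w ⊠ f) = 0 -> g ∘ braid M b w ∘ (f ⊠ id w) = 0.
Proof. by move=> e; rewrite -compA braidN compA e comp0l. Qed.

Definition desc_tensr (g : hom (w ⊗ b) c) (gf0 : g ∘ (id w ⊠ f) = 0) :
    hom (w ⊗ Q) c :=
  desc_tensl (desc_tensr_subproof gf0) ∘ braid M w Q.

Lemma desc_tensrE g gf0 : @desc_tensr g gf0 ∘ (id w ⊠ cokermap Q) = g.
Proof.
by rewrite -compA braidN compA desc_tenslE -compA braidK compm1.
Qed.

Lemma cokermap_tensl_epic : epic (cokermap Q ⊠ id w).
Proof.
move=> d u v e; apply: curry_inj; apply: (@cokermap_epic _ _ _ _ Q).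
by rewrite !curry_comp e.
Qed.

Lemma cokermap_tensr_epic : epic (id w ⊠ cokermap Q).
Proof.
move=> d u v e.
have bK (x : hom (w ⊗ Q) d) : x = x ∘ braid M Q w ∘ braid M w Q.
  by rewrite -compA braidK compm1.
rewrite (bK u) (bK v); congr (_ ∘ _); apply: cokermap_tensl_epic.
by rewrite -!compA braidN !compA e.
Qed.

End Descent.
End Closed.

Record chain_complex (A : preadditive) := ChainComplex {
  ch :> nat -> A;
  bdry : forall k, hom (ch k.+1) (ch k);
  bdry_bdry : forall k, bdry k ∘ bdry k.+1 = 0
}.

Record cochain_complex (A : preadditive) := CochainComplex {
  coch :> nat -> A;
  cobdry : forall k, hom (coch k) (coch k.+1);
  cobdry_cobdry : forall k, cobdry k.+1 ∘ cobdry k = 0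
}.

Definition deg_cast (A : category) (K : nat -> A) (n m : nat) (e : n = m) :
    hom (K n) (K m) :=
  ecast m (hom (K n) (K m)) e (idm (K n)).

Section Dual.
Variables (A : abelian_category) (M : sym_monoidal A) (cl : monoidal_closed M).
Implicit Types a b c : A.

Lemma dual_map1 a : dual_map cl (idm a) = idm (dual cl a).
Proof.
apply: (curry_uniq (m := cl)).
by rewrite ev_dual_map.
Qed.

Lemma dual_mapM a b c (g : hom b c) (f : hom a b) :
  dual_map cl (g ∘ f) = dual_map cl f ∘ dual_map cl g.
Proof. exact: ihom_mapM. Qed.

Lemma dual_mapD a b (f g : hom a b) :
  dual_map cl (f + g) = dual_map cl f + dual_map cl g.
Proof. exact: ihom_mapD. Qed.

Lemma dual_mapMz a b (f : hom a b) n :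
  dual_map cl (f *~ n) = dual_map cl f *~ n.
Proof. exact: (raddfMz (@ihom_map A M cl (munit M) a b)). Qed.

Lemma dual_deg_cast (K : nat -> A) n m (e : n = m) :
  dual_map cl (deg_cast K e) = deg_cast (fun k => dual cl (K k)) (esym e).
Proof. by case: m / e; rewrite /deg_cast /= dual_map1. Qed.

Fact dual_complex_subproof (C : chain_complex A) k :
  dual_map cl (bdry C k.+1) ∘ dual_map cl (bdry C k) = 0.
Proof.
by rewrite -dual_mapM bdry_bdry; exact: (raddf0 (@ihom_map A M cl _ _ _)).
Qed.

Definition dual_complex (C : chain_complex A) : cochain_complex A :=
  CochainComplex (dual_complex_subproof C).

End Dual.

Section Cohomology.
Variables (A : abelian_category) (K : cochain_complex A).

Definition cocycles k := ab_ker (cobdry K k).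

(* The coboundary arriving in degree k, with K_(-1) = 0. *)
Definition coch_prev k : A := if k is k'.+1 then K k' else zob A.
Definition cobdry_in k : hom (coch_prev k) (K k) :=
  match k return hom (coch_prev k) (K k) with
  | 0 => 0
  | k'.+1 => cobdry K k'
  end.

Fact cobdry_cobdry_in k : cobdry K k ∘ cobdry_in k = 0.
Proof. case: k => [|k]; [exact: comp0r | exact: cobdry_cobdry]. Qed.

Definition cobdry_cocycles k : hom (coch_prev k) (cocycles k) :=
  kerlift (cocycles k) (cobdry_cobdry_in k).

Definition cohomology k := ab_coker (cobdry_cocycles k).

End Cohomology.

(* A product on a cochain complex satisfying the Leibniz rule
   d(xy) = (dx)y + (-1)^p x(dy) for x of degree p. *)
Record dg_product (A : preadditive) (M : sym_monoidal A)
    (K : cochain_complex A) := DgProduct {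
  dgm :> forall p q, hom (tens M (K p) (K q)) (K (p + q)%N);
  leibniz : forall p q,
    cobdry K (p + q)%N ∘ dgm p q
    = dgm p.+1 q ∘ tensm M (cobdry K p) (idm (K q))
      + (deg_cast K (addnS p q)
         ∘ dgm p q.+1 ∘ tensm M (idm (K p)) (cobdry K q)) *~ (-1) ^+ p
}.

Section CohomologyProduct.
Variables (A : abelian_category) (M : sym_monoidal A) (cl : monoidal_closed M).
Variables (K : cochain_complex A) (m : dg_product M K).
Local Notation "a ⊗ b" := (tens M a b) (at level 35, right associativity).
Local Notation "f ⊠ g" := (tensm M f g) (at level 35, right associativity).
Local Notation id := idm.
Local Notation Z := (cocycles K).
Local Notation H := (cohomology K).
Local Notation z p := (kermap (Z p)).

Fact cocycles_mul_subproof p q :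
  cobdry K (p + q)%N ∘ (m p q ∘ (z p ⊠ z q)) = 0.
Proof.
rewrite compA leibniz compDl compzl -!compA -!tensmM !comp1m !comp_kermap.
rewrite (tensm_l _ 0) (tensm_r _ (kermap _) 0).
by rewrite (tensm0l cl) (tensm0r cl) !comp0l !comp0r mul0rz addr0.
Qed.

Definition cocycles_mul p q : hom (Z p ⊗ Z q) (Z (p + q)%N) :=
  kerlift (Z (p + q)%N) (cocycles_mul_subproof p q).

Lemma cocycles_mulE p q :
  z (p + q)%N ∘ cocycles_mul p q = m p q ∘ (z p ⊠ z q).
Proof. exact: kermap_lift. Qed.

Lemma cobdry_in_H n c (f : hom c (coch_prev K n)) (g : hom c (Z n)) :
  z n ∘ g = cobdry_in K n ∘ f -> cokermap (H n) ∘ g = 0.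
Proof.
move=> e.
have -> : g = cobdry_cocycles K n ∘ f.
  by apply: (@kermap_monic _ _ _ _ (Z n)); rewrite compA kermap_lift e.
by rewrite compA comp_cokermap comp0l.
Qed.

Lemma cobdry_H n j (e : n.+1 = j) c (f : hom c (K n)) (g : hom c (Z j)) :
  z j ∘ g = deg_cast K e ∘ cobdry K n ∘ f -> cokermap (H j) ∘ g = 0.
Proof.
case: j / e g => g e.
by apply: (@cobdry_in_H n.+1 _ f); rewrite e /deg_cast /= comp1m.
Qed.

Fact cohomology_mul_subproofl p q :
  cokermap (H (p + q)%N) ∘ cocycles_mul p q ∘ (cobdry_cocycles K p ⊠ id (Z q))
  = 0.
Proof.
rewrite -compA; case: p => [|p].
  have -> : cobdry_cocycles K 0 = 0 by exact: zob_to.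
  by rewrite (tensm0l cl) !comp0r.
apply: (@cobdry_in_H (p + q).+1 _ (m p q ∘ (id (K p) ⊠ z q))).
rewrite compA (cocycles_mulE p.+1 q) -compA -tensmM kermap_lift compm1 /=.
rewrite compA leibniz compDl compzl -!compA -!tensmM comp_kermap comp1m compm1.
by rewrite comp1m (tensm0r cl) !comp0r mul0rz addr0.
Qed.

Fact cohomology_mul_subproofr p q :
  cokermap (H (p + q)%N) ∘ cocycles_mul p q ∘ (id (Z p) ⊠ cobdry_cocycles K q)
  = 0.
Proof.
rewrite -compA; case: q => [|q].
  have -> : cobdry_cocycles K 0 = 0 by exact: zob_to.
  by rewrite (tensm0r cl) !comp0r.
apply: (@cobdry_H (p + q) (p + q.+1) (esym (addnS p q)) _
  ((m p q ∘ (z p ⊠ id (K q))) *~ (-1) ^+ p)).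
rewrite compA cocycles_mulE -compA -tensmM kermap_lift compm1 /=.
rewrite compzr -compA.
rewrite (compA (cobdry K (p + q)%N)) leibniz compDl compzl -!compA -!tensmM.
rewrite comp_kermap comp1m compm1 comp1m.
rewrite (tensm_l _ 0) (tensm0l cl) comp0l comp0r add0r compzr.
rewrite -mulrzA -expr2 sqrr_sign mulr1z compA.
case: _ / (addnS p q) => /=; rewrite /deg_cast /= comp1m.
by rewrite !compA comp1m.
Qed.

Fact cohomology_mul_subproof p q :
  desc_tensl cl (H p) (cohomology_mul_subproofl p q)
    ∘ (id (H p) ⊠ cobdry_cocycles K q) = 0.
Proof.
apply: (cokermap_tensl_epic cl (Q := H p)).
rewrite -compA -tensm_r tensm_l compA desc_tenslE comp0l.
exact: cohomology_mul_subproofr.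
Qed.

Definition cohomology_mul p q : hom (H p ⊗ H q) (H (p + q)%N) :=
  desc_tensr cl (H q) (cohomology_mul_subproof p q).

(* The defining property of the induced product, which determines it. *)
Lemma cohomology_mulE p q :
  cohomology_mul p q ∘ (cokermap (H p) ⊠ cokermap (H q))
  = cokermap (H (p + q)%N) ∘ cocycles_mul p q.
Proof. by rewrite tensm_r compA desc_tensrE desc_tenslE. Qed.

Lemma cohomology_mul_uniq p q c (u v : hom (H p ⊗ H q) c) :
  u ∘ (cokermap (H p) ⊠ cokermap (H q))
  = v ∘ (cokermap (H p) ⊠ cokermap (H q)) -> u = v.
Proof.
rewrite tensm_r !compA => e.
apply: (cokermap_tensr_epic cl (Q := H q)).
exact: (cokermap_tensl_epic cl (Q := H p) e).
Qed.

End CohomologyProduct.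

(* deg_cast identifies H_(q+p) with H_(p+q). *)
Definition graded_commutative (A : preadditive) (M : sym_monoidal A)
    (H : nat -> A) (mu : forall p q, hom (tens M (H p) (H q)) (H (p + q)%N)) :=
  forall p q,
    deg_cast H (addnC q p) ∘ mu q p ∘ braid M (H p) (H q)
    = mu p q *~ (-1) ^+ (p * q).

Lemma alternating_sum_eq0 (W : zmodType) (F : nat -> nat -> W) n :
  (forall i j, (i <= j)%N -> (j <= n)%N -> F i j.+1 = F j i) ->
  \sum_(i < n.+1) \sum_(j < n.+2) F i j *~ (-1) ^+ (i + j) = 0.
Proof.
move=> eF.
under eq_bigr => i _ do rewrite (bigID (fun j : 'I_n.+2 => (j <= i)%N)) /=.
rewrite big_split /= addrC.
apply/eqP; rewrite addr_eq0 -sumrN; apply/eqP.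
transitivity (\sum_(i < n.+1) \sum_(j < n.+1)
    if (i <= j)%N then - (F j i *~ (-1) ^+ (i + j)) else 0).
  apply: eq_bigr => i _; rewrite big_mkcond big_ord_recl /= add0r.
  apply: eq_bigr => j _; rewrite /bump /= add1n -ltnNge ltnS.
  case: leqP => // ij; rewrite eF -1?ltnS // addnS exprS mulN1r mulrNz //.
rewrite exchange_big; apply: eq_bigr => i _.
rewrite [in RHS]big_mkcond [in RHS]big_ord_recr /=.
have -> : (n.+1 <= i)%N = false by rewrite leqNgt ltn_ord.
rewrite addr0 -sumrN.
by apply: eq_bigr => j _; case: ifP; rewrite ?oppr0 // addnC.
Qed.

Lemma alternating_sum_split (W : zmodType) (D F G : nat -> W) p q :
  (forall i, (i <= p)%N -> D i = F i) ->
  (forall j, (j <= q)%N -> D (p + j.+1)%N = G j.+1) -> F p.+1 = G 0 ->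
  \sum_(i < (p + q).+2) D i *~ (-1) ^+ i
  = \sum_(i < p.+2) F i *~ (-1) ^+ i
    + (\sum_(j < q.+2) G j *~ (-1) ^+ j) *~ (-1) ^+ p.
Proof.
move=> eF eG e.
have -> : (p + q).+2 = (p.+1 + q.+1)%N by rewrite addSn addnS.
rewrite big_split_ord /=.
rewrite [X in _ = X + _]big_ord_recr [X in _ = _ + X *~ _]big_ord_recl /=.
rewrite e expr0 mulr1z mulrzDl exprS mulN1r mulrNz -addrA addKr.
congr (_ + _); first by apply: eq_bigr => i _; rewrite eF // -ltnS.
rewrite mulrz_suml; apply: eq_bigr => j _.
rewrite addSnnS eG -1?ltnS // -mulrzA -exprD addnC.
by [].
Qed.

Fixpoint tuple_of (T : Type) (n : nat) : Type :=
  if n is n'.+1 then (T * tuple_of T n')%type else unit.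

Definition hd (T : Type) n (t : tuple_of T n.+1) : T := t.1.
Definition tl (T : Type) n (t : tuple_of T n.+1) : tuple_of T n := t.2.

Section Magnitude.
Variables (V : category) (MV : sym_monoidal V) (cV : cartesian MV).
Variables (A : abelian_category) (M : sym_monoidal A).
Variable Sg : strong_sym_monoidal_functor MV M.
Variable X : enriched_category MV.
Local Notation "a ⊗ b" := (tens M a b) (at level 35, right associativity).
Local Notation "f ⊠ g" := (tensm M f g) (at level 35, right associativity).
Local Notation id := idm.
Local Notation "1" := (munit M).
Local Notation tup := (tuple_of X).

(* The iterated tensor product is bracketed to the right with a trailing unit,
   so that the empty product is the unit: for t = (x_1, ..., x_k), it is
     Sg X(x, x_1) ⊗ (Sg X(x_1, x_2) ⊗ (... ⊗ (Sg X(x_(k-1), x_k) ⊗ 1))). *)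
Fixpoint bar_from (k : nat) : X -> tup k -> A :=
  match k with
  | 0 => fun _ _ => 1
  | k'.+1 => fun x t => Sg (ehom x (hd t)) ⊗ bar_from (hd t) (tl t)
  end.

(* The summand of B_k at u = (x_0, ..., x_k). *)
Definition bar (k : nat) (u : tup k.+1) : A := bar_from (hd u) (tl u).

Definition erase (x y : X) : hom (Sg (ehom x y)) 1 :=
  bwd (phi0 Sg) ∘ fmap Sg (bang cV (ehom x y)).

Definition compose (x y z : X) :
    hom (Sg (ehom x y) ⊗ Sg (ehom y z)) (Sg (ehom x z)) :=
  fmap Sg (ecomp x y z) ∘ phi Sg (ehom x y) (ehom y z).

Definition erase_first (k : nat) (x : X) (t : tup k.+1) :
    hom (bar_from x t) (bar t) :=
  lunit M _ ∘ (erase x (hd t) ⊠ id (bar t)).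

Definition compose_first (k : nat) (x : X) (t : tup k.+2) :
    hom (bar_from x t) (bar_from x (tl t)) :=
  (compose x (hd t) (hd (tl t)) ⊠ id _) ∘ bwd (assoc M _ _ _).

(* (x_1, ..., x_(k+1)) without x_(i+1), for i <= k. *)
Fixpoint omit (k i : nat) : tup k.+1 -> tup k :=
  match k with
  | 0 => fun _ => tt
  | k'.+1 => fun t =>
      match i with 0 => tl t | i'.+1 => (hd t, omit i' (tl t)) end
  end.

(* For i <= k, the (i+1)-st face on the summand of (x, x_1, ..., x_(k+1)): it
   erases the last factor if i = k, and composes two factors if i < k. *)
Fixpoint face_from (k i : nat) :
    forall (x : X) (t : tup k.+1), hom (bar_from x t) (bar_from x (omit i t)) :=
  match k with
  | 0 => fun x t => lunit M _ ∘ (erase x (hd t) ⊠ id 1)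
  | k'.+1 =>
      match i with
      | 0 => fun x t => compose_first x t
      | i'.+1 => fun x t => id (Sg (ehom x (hd t))) ⊠ face_from i' (hd t) (tl t)
      end
  end.

Variable sums : forall k, coproduct (@bar k).
Local Notation B k := (coprod (sums k)).
Local Notation "'ι' u" := (inj (sums _) u) (at level 10, u at level 9).

Definition face (k i : nat) : hom (B k.+1) (B k) :=
  match i with
  | 0 => copair (sums k.+1) (fun u => ι (tl u) ∘ erase_first (hd u) (tl u))
  | i'.+1 => copair (sums k.+1) (fun u =>
      ι ((hd u, omit i' (tl u)) : tup k.+1) ∘ face_from i' (hd u) (tl u))
  end.

Definition magnitude_bdry (k : nat) : hom (B k.+1) (B k) :=
  \sum_(i < k.+2) face k i *~ (-1) ^+ i.

Lemma compose_assoc x y z w :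
  compose x z w ∘ (compose x y z ⊠ id (Sg (ehom z w)))
  = compose x y w ∘ (id (Sg (ehom x y)) ⊠ compose y z w) ∘ assoc M _ _ _.
Proof.
have nl : phi Sg (ehom x z) (ehom z w)
      ∘ (fmap Sg (ecomp x y z) ⊠ id (Sg (ehom z w)))
    = fmap Sg (tensm MV (ecomp x y z) (idm _)) ∘ phi Sg _ _.
  by rewrite -fmap1 phiN.
have nr : phi Sg (ehom x y) (ehom y w)
      ∘ (id (Sg (ehom x y)) ⊠ fmap Sg (ecomp y z w))
    = fmap Sg (tensm MV (idm _) (ecomp y z w)) ∘ phi Sg _ _.
  by rewrite -fmap1 phiN.
rewrite /compose tensmMl tensmMr !compA.
rewrite -(compA (fmap Sg (ecomp x z w)) (phi Sg _ _)) nl.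
rewrite -(compA (fmap Sg (ecomp x y w)) (phi Sg _ _)) nr.
rewrite !compA -!fmapM ecompA fmapM -!compA; congr (_ ∘ _).
by rewrite !compA phi_assoc.
Qed.

Lemma erase_compose x y z :
  erase x z ∘ compose x y z = lunit M 1 ∘ (erase x y ⊠ erase y z).
Proof.
rewrite /erase /compose.
set e1 := bang cV (ehom x y); set e2 := bang cV (ehom y z).
have e : bang cV (ehom x z) ∘ ecomp x y z = lunit MV (munit MV) ∘ tensm MV e1 e2.
  by rewrite (bang_uniq cV (_ ∘ _)) [RHS](bang_uniq cV).
rewrite tensmM !compA -(compA (bwd (phi0 Sg))) -fmapM e fmapM.
rewrite !compA -(compA (bwd (phi0 Sg) ∘ _)) phiN compA; congr (_ ∘ _).
have u : lunit M (Sg (munit MV)) ∘ (bwd (phi0 Sg) ⊠ id _)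
    = fmap Sg (lunit MV (munit MV)) ∘ phi Sg (munit MV) (munit MV).
  by rewrite -phi_lunit -compA -tensmM bwdK comp1m tensm1 compm1.
by rewrite -compA -u compA -lunitN -compA -tensmM comp1m compm1.
Qed.

Lemma erase_compose_tens x y z (T : A) :
  lunit M T ∘ (erase x z ⊠ id T)
    ∘ ((compose x y z ⊠ id T) ∘ bwd (assoc M _ _ _))
  = lunit M T ∘ (erase y z ⊠ id T) ∘ (lunit M _ ∘ (erase x y ⊠ id _)).
Proof.
rewrite !compA -(compA (lunit M T)) -tensmMl erase_compose tensmMl.
rewrite -[LHS]compA -(compA (lunit M 1 ⊠ id T)) -assocNV.
rewrite (compA (lunit M 1 ⊠ id T)) lunit_tensV.
rewrite -(compA (lunit M T) (erase y z ⊠ id T)) -lunitN.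
by rewrite -!compA -tensm_r.
Qed.

Lemma erase_compose_last x y z :
  lunit M 1 ∘ (erase x z ⊠ id 1)
    ∘ ((compose x y z ⊠ id 1) ∘ bwd (assoc M _ _ _))
  = lunit M 1 ∘ (erase x y ⊠ id 1)
    ∘ (id _ ⊠ (lunit M 1 ∘ (erase y z ⊠ id 1))).
Proof.
rewrite erase_compose_tens compA -lunitN.
by rewrite -!compA -tensm_l -tensm_r.
Qed.

Lemma compose_assoc_tens x y z w (T : A) :
  (compose x z w ⊠ id T) ∘ bwd (assoc M _ _ _)
    ∘ ((compose x y z ⊠ id _) ∘ bwd (assoc M _ _ _))
  = (compose x y w ⊠ id T) ∘ bwd (assoc M _ _ _)
    ∘ (id _ ⊠ ((compose y z w ⊠ id T) ∘ bwd (assoc M _ _ _))).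
Proof.
rewrite tensmMr !compA -[in LHS](compA (compose x z w ⊠ id T)).
rewrite -(tensm1 M _ T) assocNV compA -tensmMl compose_assoc.
rewrite -[in RHS](compA (compose x y w ⊠ id T)) assocNV compA -tensmMl.
rewrite tensmMl -!compA; congr (_ ∘ _).
rewrite pentagonV -!compA (compA (assoc M _ _ _ ⊠ id T)) -tensmMl bwdK.
by rewrite tensm1 comp1m.
Qed.

Lemma compose_interchange x y z (T U : A) (g : hom T U) :
  (id _ ⊠ g) ∘ ((compose x y z ⊠ id T) ∘ bwd (assoc M _ _ _))
  = (compose x y z ⊠ id U) ∘ bwd (assoc M _ _ _) ∘ (id _ ⊠ (id _ ⊠ g)).
Proof.
by rewrite -[RHS]compA assocNV tensm1 !compA -tensm_r -tensm_l.
Qed.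

Lemma face_face_from k i j x (t : tup k.+2) : (i <= j <= k)%N ->
  existT (fun t' => hom (bar_from x t) (bar_from x t'))
    (omit j (omit i t)) (face_from j x (omit i t) ∘ face_from i x t)
  = existT (fun t' => hom (bar_from x t) (bar_from x t'))
    (omit i (omit j.+1 t)) (face_from i x (omit j.+1 t) ∘ face_from j.+1 x t).
Proof.
elim: k i j x t => [|k IH] i j x t /andP[ij jk].
  move: jk ij; rewrite leqn0 => /eqP ->; rewrite leqn0 => /eqP -> /=.
  case: t => y [z []]; congr (existT _ _ _); exact: erase_compose_last.
case: i j ij jk => [|i] [|j] //= ij jk.
- congr (existT _ _ _); exact: compose_assoc_tens.
- congr (existT _ _ _); exact: compose_interchange.
pose G (o : {t' : tup k & hom (bar_from (hd t) (tl t)) (bar_from (hd t) t')})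
  := existT (fun t' => hom (bar_from x t) (bar_from x t'))
       ((hd t, projT1 o) : tup k.+1) (id (Sg (ehom x (hd t))) ⊠ projT2 o).
have ijk : (i <= j <= k)%N by apply/andP.
have := congr1 G (IH i j (hd t) (tl t) ijk).
by rewrite /G /= !tensmMr.
Qed.

Lemma face0E k (u : tup k.+2) :
  face k 0 ∘ ι u = ι (tl u) ∘ erase_first (hd u) (tl u).
Proof. exact: copair_inj. Qed.

Lemma faceSE k i (u : tup k.+2) :
  face k i.+1 ∘ ι u
  = ι ((hd u, omit i (tl u)) : tup k.+1) ∘ face_from i (hd u) (tl u).
Proof. exact: copair_inj. Qed.

Lemma face_face k i j : (i <= j <= k.+1)%N ->
  face k i ∘ face k.+1 j.+1 = face k j ∘ face k.+1 i.
Proof.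
move=> /andP[ij jk]; apply: (@copair_uniq _ _ _ (sums k.+2)) => u.
rewrite -!compA faceSE; case: i ij => [|i] ij.
  rewrite face0E [LHS]compA face0E -[LHS]compA.
  case: j {ij} jk => [|j] jk.
    rewrite [RHS]compA face0E -[RHS]compA; congr (_ ∘ _).
    exact: erase_compose_tens.
  rewrite [RHS]compA faceSE -[RHS]compA; congr (_ ∘ _).
  rewrite /erase_first [RHS]compA -lunitN -!compA; congr (_ ∘ _).
  by rewrite -tensm_l -tensm_r.
case: j ij jk => // j ij jk.
rewrite faceSE [LHS]compA faceSE -[LHS]compA [RHS]compA faceSE -[RHS]compA.
pose G (o : {t' : tup k & hom (bar u) (bar_from (hd u) t')})
  := ι ((hd u, projT1 o) : tup k.+1) ∘ projT2 o.
have ijk : (i <= j <= k)%N by apply/andP.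
have := congr1 G (face_face_from (hd u) (tl u) ijk).
by move=> /esym.
Qed.

Lemma magnitude_bdry_bdry k : magnitude_bdry k ∘ magnitude_bdry k.+1 = 0.
Proof.
pose F i j := face k i ∘ face k.+1 j.
have e i j : (i <= j)%N -> (j <= k.+1)%N -> F i j.+1 = F j i.
  by move=> ij jk; apply: face_face; rewrite ij.
rewrite /magnitude_bdry comp_suml.
transitivity (\sum_(i < k.+2) \sum_(j < k.+3) F i j *~ (-1) ^+ (i + j)).
  apply: eq_bigr => i _; rewrite compzl comp_sumr mulrz_suml.
  by apply: eq_bigr => j _; rewrite compzr exprD mulrC mulrzA.
exact: alternating_sum_eq0.
Qed.

Definition magnitude_chains : chain_complex A :=
  ChainComplex magnitude_bdry_bdry.
(* (x_1, ..., x_p) and (x_p, ..., x_(p+q)), with x_0 := x. *)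
Fixpoint front (p q : nat) : tup (p + q) -> tup p :=
  match p return tup (p + q) -> tup p with
  | 0 => fun _ => tt
  | p'.+1 => fun t => (hd t, front (tl t))
  end.

Fixpoint back (p q : nat) : X -> tup (p + q) -> tup q.+1 :=
  match p return X -> tup (p + q) -> tup q.+1 with
  | 0 => fun x t => (x, t)
  | p'.+1 => fun _ t => back (hd t) (tl t)
  end.

Fixpoint rebracket (p q : nat) : forall (x : X) (t : tup (p + q)),
    hom (bar_from x t) (bar_from x (front t) ⊗ bar (back x t)) :=
  match p return forall (x : X) (t : tup (p + q)),
    hom (bar_from x t) (bar_from x (front t) ⊗ bar (back x t)) with
  | 0 => fun x t => bwd (lunit M _)
  | p'.+1 => fun x t =>
      bwd (assoc M _ _ _) ∘ (id (Sg (ehom x (hd t))) ⊠ rebracket (hd t) (tl t))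
  end.

Definition comult (p q : nat) : hom (B (p + q)%N) (B p ⊗ B q) :=
  copair (sums (p + q)%N) (fun u =>
    (ι ((hd u, front (tl u)) : tup p.+1) ⊠ ι (back (hd u) (tl u)))
    ∘ rebracket (hd u) (tl u)).

Lemma comultE p q (u : tup (p + q).+1) :
  comult p q ∘ ι u
  = (ι ((hd u, front (tl u)) : tup p.+1) ⊠ ι (back (hd u) (tl u)))
    ∘ rebracket (hd u) (tl u).
Proof. exact: copair_inj. Qed.

(* Maps out of a fixed object into the summands of B_k, and of B_p ⊗ B_q. *)
Local Notation out P x k := {t : tup k & hom P (bar_from x t)}.
Local Notation out2 P x p q :=
  {w : tup p * tup q.+1 & hom P (bar_from x w.1 ⊗ bar w.2)}.
Local Notation Out P x t h := (existT (fun t' => hom P (bar_from x t')) t h).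
Local Notation Out2 P x t u h :=
  (existT (fun w => hom P (bar_from x w.1 ⊗ bar w.2)) (t, u) h).

Definition out2_cons p q x y (P : A) (o : out2 P y p q) :
    out2 (Sg (ehom x y) ⊗ P) x p.+1 q :=
  Out2 (Sg (ehom x y) ⊗ P) x ((y, (projT1 o).1) : tup p.+1) (projT1 o).2
    (bwd (assoc M _ _ _) ∘ (id (Sg (ehom x y)) ⊠ projT2 o)).

Lemma rebracket_face_front p q i x (t : tup (p + q).+1) : (i < p)%N ->
  Out2 (bar_from x t) x (front (omit i t)) (back x (omit i t))
    (rebracket x (omit i t) ∘ face_from i x t)
  = Out2 (bar_from x t) x
      (omit i (front (t : tup (p.+1 + q)))) (back x (t : tup (p.+1 + q)))
      ((face_from i x (front (t : tup (p.+1 + q))) ⊠ id _)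
       ∘ rebracket x (t : tup (p.+1 + q))).
Proof.
elim: p i x t => [|p IH] [|i] x t //= ip.
  by congr (existT _ _ _); exact: assoc_interchange.
have e := congr1 (@out2_cons p q x (hd t) (bar (t : tup (p + q).+2)))
  (IH i (hd t) (tl t) ip).
apply: (etrans (etrans _ e)); congr (existT _ _ _).
  by rewrite /= tensmMr -compA.
exact: assoc_stepl.
Qed.

Lemma rebracket_erase_first p q x (t : tup (p.+1 + q)) :
  rebracket (hd t) (tl t : tup (p + q)) ∘ erase_first x (t : tup (p + q).+1)
  = (erase_first x (front t) ⊠ id _) ∘ rebracket x t.
Proof.
exact: erase_interchange.
Qed.

Fixpoint shift (p q : nat) : tup (p + q).+1 -> tup (p + q.+1) :=
  match p return tup (p + q).+1 -> tup (p + q.+1) with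
  | 0 => fun t => t
  | p'.+1 => fun t => (hd t, shift (tl t))
  end.

Fixpoint shift_map (p q : nat) :
    forall x (t : tup (p + q).+1), hom (bar_from x t) (bar_from x (shift t)) :=
  match p return
    forall x (t : tup (p + q).+1), hom (bar_from x t) (bar_from x (shift t)) with
  | 0 => fun x t => id _
  | p'.+1 => fun x t => id (Sg (ehom x (hd t))) ⊠ shift_map (hd t) (tl t)
  end.

Lemma rebracket_face_back p q j x (t : tup (p + q).+1) : (j <= q)%N ->
  Out2 (bar_from x t) x (front (omit (p + j) t)) (back x (omit (p + j) t))
    (rebracket x (omit (p + j) t) ∘ face_from (p + j) x t)
  = Out2 (bar_from x t) x (front (shift t))
      (hd (back x (shift t)), omit j (tl (back x (shift t))))
      ((id _ ⊠ face_from j (hd (back x (shift t))) (tl (back x (shift t))))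
       ∘ rebracket x (shift t) ∘ shift_map x t).
Proof.
move=> jq; elim: p x t => [|p IH] x t /=.
  by congr (existT _ _ _); rewrite compm1 lunitNV.
have e := congr1 (@out2_cons p q x (hd t) (bar (t : tup (p + q).+2)))
  (IH (hd t) (tl t)).
apply: (etrans (etrans _ e)); congr (existT _ _ _).
  by rewrite /= tensmMr -compA.
exact: assoc_stepr.
Qed.

Lemma rebracket_middle p q x (t : tup (p + q).+1) :
  Out2 (bar_from x t) x
    (omit p (front (t : tup (p.+1 + q)))) (back x (t : tup (p.+1 + q)))
    ((face_from p x (front (t : tup (p.+1 + q))) ⊠ id _)
     ∘ rebracket x (t : tup (p.+1 + q)))
  = Out2 (bar_from x t) x (front (shift t)) (tl (back x (shift t)))
      ((id _ ⊠ erase_first (hd (back x (shift t))) (tl (back x (shift t))))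
       ∘ rebracket x (shift t) ∘ shift_map x t).
Proof.
elim: p x t => [|p IH] x t /=.
  case: t => y t; congr (existT _ _ _).
  by rewrite -erase_interchange compm1 -lunitNV.
have e := congr1 (@out2_cons p q x (hd t) (bar (t : tup (p + q).+2)))
  (IH (hd t) (tl t)).
apply: (etrans (etrans _ e)); congr (existT _ _ _).
  by symmetry; exact: assoc_stepl.
exact: assoc_stepr.
Qed.

Definition cast_out n m (e : n = m) x (t : tup n) : out (bar_from x t) x m :=
  match e with erefl => Out (bar_from x t) x t (id _) end.

Lemma deg_castE n m (e : n = m) (u : tup n.+1) :
  deg_cast (fun k => B k) e ∘ ι u
  = ι ((hd u, projT1 (cast_out e (hd u) (tl u))) : tup m.+1)
    ∘ projT2 (cast_out e (hd u) (tl u)).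
Proof. by case: m / e; rewrite comp1m /= compm1; case: u. Qed.

Lemma cast_out_cons n m (e : n = m) x (t : tup n.+1) :
  cast_out (congr1 succn e) x t
  = Out (bar_from x t) x
      ((hd t, projT1 (cast_out e (hd t) (tl t))) : tup m.+1)
      (id (Sg (ehom x (hd t))) ⊠ projT2 (cast_out e (hd t) (tl t))).
Proof. by case: m / e => /=; rewrite tensm1; case: t. Qed.

Lemma cast_out_shift p q (e : (p + q).+1 = (p + q.+1)%N) x
    (t : tup (p + q).+1) :
  cast_out e x t = Out (bar_from x t) x (shift t) (shift_map x t).
Proof.
elim: p e x t => [|p IH] e x t; first by rewrite (eq_irrelevance e erefl).
have e' : (p + q).+1 = (p + q.+1)%N by rewrite addnS.
have -> : e = congr1 succn e' by exact: eq_irrelevance.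
by rewrite cast_out_cons IH.
Qed.

Variable cl : monoidal_closed M.

Definition out2_inj p q x P (o : out2 P x p q) : hom P (B p ⊗ B q) :=
  (ι ((x, (projT1 o).1) : tup p.+1) ⊠ ι (projT1 o).2) ∘ projT2 o.

Lemma comult_face_front p q i : (i <= p)%N ->
  comult p q ∘ face (p + q) i = (face p i ⊠ id _) ∘ comult p.+1 q.
Proof.
move=> ip; apply: (@copair_uniq _ _ _ (sums (p + q).+1)) => u.
rewrite -!compA (@comultE p.+1 q u); case: i ip => [|i] ip.
  rewrite face0E compA comultE -compA rebracket_erase_first.
  by rewrite [RHS]compA -tensmM face0E [LHS]compA -tensmM comp1m compm1.
rewrite faceSE [LHS]compA comultE [RHS]compA -tensmM faceSE comp1m.
have e := congr1 (@out2_inj p q (hd u) (bar u))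
  (rebracket_face_front (hd u) (tl u) ip).
rewrite -[LHS]compA; apply: (etrans e).
by rewrite /out2_inj /= compA -tensmM compm1.
Qed.

Lemma comult_face_back p q j (e : (p + q).+1 = (p + q.+1)%N) :
  (j <= q)%N ->
  comult p q ∘ face (p + q) (p + j.+1)
  = (id _ ⊠ face q j.+1) ∘ comult p q.+1 ∘ deg_cast (fun k => B k) e.
Proof.
move=> jq; apply: (@copair_uniq _ _ _ (sums (p + q).+1)) => u.
rewrite addnS -!compA deg_castE cast_out_shift faceSE [LHS]compA comultE.
rewrite [X in _ = _ ∘ X]compA comultE.
have h := congr1 (@out2_inj p q (hd u) (bar u))
  (rebracket_face_back (hd u) (tl u) jq).
rewrite -[LHS]compA; apply: (etrans h).
by rewrite /out2_inj /= !compA -!tensmM !compm1 comp1m copair_inj.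
Qed.

Lemma comult_face_middle p q (e : (p + q).+1 = (p + q.+1)%N) :
  (face p p.+1 ⊠ id _) ∘ comult p.+1 q
  = (id _ ⊠ face q 0) ∘ comult p q.+1 ∘ deg_cast (fun k => B k) e.
Proof.
apply: (@copair_uniq _ _ _ (sums (p + q).+1)) => u.
rewrite -!compA deg_castE cast_out_shift (@comultE p.+1 q u).
rewrite [LHS]compA -tensmM faceSE.
rewrite [X in _ = _ ∘ X]compA comultE.
have h := congr1 (@out2_inj p q (hd u) (bar u))
  (rebracket_middle (hd u) (tl u)).
rewrite comp1m /= [RHS]compA [X in _ = X ∘ _]compA -tensmM face0E comp1m.
rewrite /out2_inj /= [LHS]compA -tensmM compm1 in h; rewrite {}h.
by rewrite [LHS]compA [X in X ∘ _ = _]compA -tensmM compm1.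
Qed.


(* The maps comult p q are the components of a chain map C -> C ⊗ C. *)
Lemma comult_bdry p q (e : (p + q).+1 = (p + q.+1)%N) :
  comult p q ∘ magnitude_bdry (p + q)
  = (magnitude_bdry p ⊠ id _) ∘ comult p.+1 q
    + ((id _ ⊠ magnitude_bdry q) ∘ comult p q.+1
       ∘ deg_cast (fun k => B k) e) *~ (-1) ^+ p.
Proof.
rewrite /magnitude_bdry comp_sumr.
rewrite (tensm_suml cl) (tensm_sumr cl) !comp_suml.
under eq_bigr => i _ do rewrite compzr.
under [X in _ = X + _]eq_bigr => i _ do rewrite (tensmzl cl) compzl.
under [X in _ = _ + X *~ _]eq_bigr => i _ do rewrite (tensmzr cl) !compzl.
apply: (@alternating_sum_split _ (fun i => comult p q ∘ face (p + q) i)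
  (fun i => (face p i ⊠ id _) ∘ comult p.+1 q)
  (fun j => (id _ ⊠ face q j) ∘ comult p q.+1
     ∘ deg_cast (fun k => B k) e)).
- exact: comult_face_front.
- by move=> j; exact: comult_face_back.
exact: comult_face_middle.
Qed.

Definition magnitude_cochains : cochain_complex A :=
  dual_complex cl magnitude_chains.

Definition cochain_mul p q :
    hom (dual cl (B p) ⊗ dual cl (B q)) (dual cl (B (p + q)%N)) :=
  dual_map cl (comult p q) ∘ dual_tens cl (B p) (B q).

Fact cochain_mul_leibniz p q :
  cobdry magnitude_cochains (p + q)%N ∘ cochain_mul p q
  = cochain_mul p.+1 q ∘ (cobdry magnitude_cochains p ⊠ id _)
    + (deg_cast magnitude_cochains (addnS p q)
       ∘ cochain_mul p q.+1 ∘ (id _ ⊠ cobdry magnitude_cochains q))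
      *~ (-1) ^+ p.
Proof.
rewrite /cochain_mul /= compA -dual_mapM 
  (comult_bdry (esym (addnS p q))).
rewrite dual_mapD dual_mapMz !dual_mapM compDl compzl.
by rewrite -!compA !dual_tensN !dual_map1 dual_deg_cast esymK.
Qed.

Definition magnitude_dg_product : dg_product M magnitude_cochains :=
  @DgProduct _ M magnitude_cochains cochain_mul cochain_mul_leibniz.

Definition magnitude_cohomology : nat -> A := cohomology magnitude_cochains.

Definition magnitude_cup p q :
    hom (magnitude_cohomology p ⊗ magnitude_cohomology q)
        (magnitude_cohomology (p + q)%N) :=
  cohomology_mul cl magnitude_dg_product p q.

End Magnitude.

(* Main.v *)
From HB Require Import structures.
From mathcomp Require Import ssrAC all_boot all_algebra boolp zify.
Require Import Defs.

Set Implicit Arguments.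
Unset Strict Implicit.
Unset Printing Implicit Defensive.

Import GRing.Theory.
Local Open Scope ring_scope.
Local Open Scope cat_scope.

(** Why the cup product is graded commutative.

    A cartesian V makes every object a cocommutative comonoid, through its
    diagonal and its map to the unit.  A strong symmetric monoidal functor
    carries this structure to A: each summand of the bar construction is, up
    to a canonical isomorphism, the image of an object of V, hence a
    cocommutative comonoid, and every map that comes from V respects the
    comonoid structures ([copyN], [braid_copy]).  The faces come from V, so
    the magnitude nerve B is a semisimplicial cocommutative coalgebra
    ([bar_copy_face], [braid_bar_copy]).

    A map from a comonoid to a tensor product is recovered from its two
    components when it comes from V ([representable_eta]).  Applied to the
    rebracketing map, this says that the coproduct of chains is the
    Alexander-Whitney map of this coalgebra: copy a simplex, then take the
    front p-face of one copy and the back q-face of the other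
    ([comult_front_back]).  Dually, with d_i the cofaces of cochains, e the
    last coface and P the pointwise product of cochains, the product of x in
    degree p and y in degree q is P (e^q x) (d_0^p y), and swapping the two
    factors turns the product of y and x into P (d_0^q x) (e^p y).

    From here the argument is the one of Steenrod for simplicial sets.  The
    cup-1 product sum_j (-1)^(j(q-1)) P (d_(j+1)^(q-1) x) (d_0^j e^(p-1-j) y)
    has, when x and y are cocycles, a coboundary equal up to sign to the
    difference of P (d_0^q x) (e^p y) and (-1)^(pq) P (e^q x) (d_0^p y).  Its
    proof is a computation with the cosimplicial identities and the
    compatibility of P with cofaces, so [cup1] establishes it for abstract abelian groups
    with coface operators.  It is applied to the cocycles kermap, viewed as
    generalized elements of the cochains, and the resulting identity descends
    to cohomology because both quotient maps are epimorphisms. *)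

Section Subtraction.
Variable A : preadditive.
Implicit Types a b c : A.

Lemma compBr a b c (g : hom b c) (f f' : hom a b) :
  g ∘ (f - f') = g ∘ f - g ∘ f'.
Proof. exact: (raddfB (@postcomp A a b c g)). Qed.

Lemma compBl a b c (g g' : hom b c) (f : hom a b) :
  (g - g') ∘ f = g ∘ f - g' ∘ f.
Proof. exact: (raddfB (@precomp A a b c f)). Qed.

End Subtraction.

(** * Coherence in symmetric monoidal categories *)

Section SymmetricCoherence.
Variables (C : category) (M : sym_monoidal C).
Implicit Types a b c d : C.
Local Notation "a ⊗ b" := (tens M a b) (at level 35, right associativity).
Local Notation "f ⊠ g" := (tensm M f g) (at level 35, right associativity).
Local Notation id := idm.
Local Notation "1" := (munit M).

(** The counterpart of [lunit_tens] for the right unit: once tensored with the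
    unit, both sides agree by the pentagon and the triangle. *)
Lemma runit_tens a b :
  (id a ⊠ runit M b) ∘ assoc M a b 1 = runit M (a ⊗ b).
Proof.
apply: tens_unit_inj; apply: (iso_monic (i := assoc M a b 1)).
rewrite -triangle [RHS]compA -(tensm1 M a b) assocN -[RHS]compA pentagon.
rewrite [RHS]compA [in RHS]compA -tensmMr triangle -assocN.
by rewrite tensmMl !compA.
Qed.

Lemma runit_tensV a b :
  runit M (a ⊗ b) ∘ bwd (assoc M a b 1) = id a ⊠ runit M b.
Proof. by rewrite -runit_tens -compA bwdK compm1. Qed.

Lemma braid_monic a b c (u v : hom c (a ⊗ b)) :
  braid M a b ∘ u = braid M a b ∘ v -> u = v.
Proof.
by move=> e; rewrite -(comp1m u) -(comp1m v) -(braidK M a b) -!compA e.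
Qed.

(** The hexagon with the unit in the middle, followed by the left unit, becomes
    this equation tensored with 1 and followed by a braiding. *)
Lemma lunit_braid a : lunit M a ∘ braid M a 1 = runit M a.
Proof.
apply: tens_unit_inj; apply: braid_monic.
transitivity (lunit M (1 ⊗ a) ∘ ((id 1 ⊠ braid M a 1) ∘ assoc M 1 a 1
    ∘ (braid M a 1 ⊠ id 1))).
  by rewrite !compA lunitN -!compA (compA (lunit M _)) lunit_tens -tensmMl.
by rewrite -hexagon !compA lunit_tens -braidN -triangle compA.
Qed.

Lemma pentagon_inner x y z w :
  (assoc M x y z ⊠ id w) ∘ bwd (assoc M (x ⊗ y) z w)
  = bwd (assoc M x (y ⊗ z) w) ∘ (id x ⊠ bwd (assoc M y z w))
    ∘ assoc M x y (z ⊗ w).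
Proof.
apply: (iso_epic (i := assoc M (x ⊗ y) z w)).
rewrite -[LHS]compA fwdK compm1 -!compA pentagon -!compA.
rewrite (compA (id x ⊠ bwd _)) -tensmMr fwdK tensm1 comp1m.
by rewrite !compA fwdK comp1m.
Qed.

Lemma pentagon_outer x y z w :
  assoc M (x ⊗ y) z w ∘ (bwd (assoc M x y z) ⊠ id w)
  = bwd (assoc M x y (z ⊗ w)) ∘ (id x ⊠ assoc M y z w) ∘ assoc M x (y ⊗ z) w.
Proof.
apply: (iso_monic (i := assoc M x y (z ⊗ w))).
rewrite !compA pentagon bwdK comp1m -!compA.
by rewrite -tensmMl bwdK tensm1 compm1.
Qed.

(** The hexagon solved for the braiding past a tensor product; symmetry gives
    the version with the tensor product on the other side. *)
Lemma braid_tensr x y z :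
  braid M x (y ⊗ z)
  = bwd (assoc M y z x) ∘ (id y ⊠ braid M x z) ∘ assoc M y x z
    ∘ (braid M x y ⊠ id z) ∘ bwd (assoc M x y z).
Proof.
apply: (iso_epic (i := assoc M x y z)); rewrite -[RHS]compA fwdK compm1.
by rewrite -!compA [(id y ⊠ _) ∘ _]compA -hexagon !compA fwdK comp1m.
Qed.

Lemma braid_tensl x y z :
  braid M (x ⊗ y) z
  = assoc M z x y ∘ (braid M x z ⊠ id y) ∘ bwd (assoc M x z y)
    ∘ (id x ⊠ braid M y z) ∘ assoc M x y z.
Proof.
apply: braid_monic; rewrite braidK braid_tensr -!compA.
rewrite (compA (bwd (assoc M z x y)) (assoc M z x y)) fwdK comp1m.
rewrite (compA (braid M z x ⊠ id y)) -tensmMl braidK tensm1 comp1m.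
rewrite (compA (assoc M x z y)) bwdK comp1m.
by rewrite (compA (id x ⊠ braid M z y)) -tensmMr braidK tensm1 comp1m fwdK.
Qed.

End SymmetricCoherence.

Section InterchangeBraid.
Variables (A : abelian_category) (M : sym_monoidal A).
Implicit Types a b c d : A.
Local Notation "a ⊗ b" := (tens M a b) (at level 35, right associativity).
Local Notation "f ⊠ g" := (tensm M f g) (at level 35, right associativity).
Local Notation id := idm.

(** Swapping the blocks of (a ⊗ c) ⊗ (b ⊗ d) is the same as swapping inside
    (a ⊗ b) and (c ⊗ d); this is what makes the canonical map from a tensor
    product of duals to the dual of the tensor product symmetric. *)
Lemma interchange_braid a b c d :
  braid M (a ⊗ c) (b ⊗ d) ∘ interchange M a b c d
  = interchange M b a d c ∘ (braid M a b ⊠ braid M c d).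
Proof.
(* The factor (a, c) passes b ⊗ d one object at a time; the crossing of
   c and b undoes the one made by the interchange. *)
have cross : braid M c (b ⊗ d)
      ∘ (assoc M c b d ∘ ((braid M b c ⊠ id d) ∘ bwd (assoc M b c d)))
    = bwd (assoc M b d c) ∘ (id b ⊠ braid M c d).
  rewrite braid_tensr -!compA (compA (bwd (assoc M c b d))) fwdK comp1m.
  rewrite (compA (braid M c b ⊠ id d)) -tensmMl braidK tensm1 comp1m.
  by rewrite bwdK compm1.
rewrite braid_tensl {1}/interchange -!compA.
rewrite (compA (assoc M a c (b ⊗ d)) (bwd _)) bwdK comp1m.
rewrite (compA (id a ⊠ braid M c (b ⊗ d))) -tensmMr cross.
rewrite tensmMr -!compA -assocN tensm1.
rewrite (compA (id a ⊠ bwd _)) 2!(compA (bwd (assoc M a (b ⊗ d) c))).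
rewrite -pentagon_inner (tensm_l _ (braid M a b)) [RHS]compA.
rewrite !compA; congr (_ ∘ _).
rewrite -[X in X ∘ _]compA -tensmMl braid_tensr.
rewrite -[in X in X ∘ _]compA fwdK compm1 -[in X in X ∘ _]compA.
rewrite !tensmMl -!compA -assocNV tensm1 (compA (assoc M b a d ⊠ id c)).
rewrite pentagon_inner !compA; congr (_ ∘ _ ∘ _).
rewrite pentagon_outer -!compA (compA (assoc M b (d ⊗ a) c)) assocN.
rewrite !tensmMr -!compA; congr (_ ∘ (_ ∘ (_ ∘ _))).
by rewrite (compA (assoc M b (a ⊗ d) c)) bwdK comp1m.
Qed.

End InterchangeBraid.

Section DualBraid.
Variables (A : abelian_category) (M : sym_monoidal A) (cl : monoidal_closed M).
Implicit Types a b : A.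
Local Notation "f ⊠ g" := (tensm M f g) (at level 35, right associativity).
Local Notation id := idm.

Lemma dual_tens_braid a b :
  dual_map cl (braid M a b) ∘ dual_tens cl b a
    ∘ braid M (dual cl a) (dual cl b) = dual_tens cl a b.
Proof.
apply: (curry_uniq (m := cl)); rewrite [RHS]curryK.
rewrite !tensmMl compA [X in X ∘ _ = _]compA ev_dual_map.
rewrite -[X in X ∘ _ = _]compA -tensm_r tensm_l [X in X ∘ _ = _]compA curryK.
rewrite -[LHS]compA -[X in X ∘ _ = _]compA -[LHS]compA -[X in _ ∘ X = _]compA.
rewrite -tensm_r -interchange_braid [X in _ ∘ X = _]compA -braidN.
rewrite -[X in _ ∘ X = _]compA [LHS]compA lunit_braid -lunit_unit.
by rewrite [LHS]compA.
Qed.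

End DualBraid.

(** * Comonoids coming from a cartesian category *)

Section Cartesian.
Variables (V : category) (MV : sym_monoidal V) (cV : cartesian MV).
Implicit Types a b c : V.
Local Notation "f ⊠ g" := (tensm MV f g) (at level 35, right associativity).
Local Notation id := idm.
Local Notation fst := (cart_fst cV).
Local Notation snd := (cart_snd cV).

Lemma cart_fst_tensm a a' b b' (f : hom a a') (g : hom b b') :
  fst a' b' ∘ (f ⊠ g) = f ∘ fst a b.
Proof.
rewrite /cart_fst -compA -tensmM comp1m (bang_uniq cV (_ ∘ g)).
by rewrite [RHS]compA -runitN -compA -tensmM compm1 comp1m.
Qed.

Lemma cart_snd_tensm a a' b b' (f : hom a a') (g : hom b b') :
  snd a' b' ∘ (f ⊠ g) = g ∘ snd a b.
Proof.
rewrite /cart_snd -compA -tensmM comp1m (bang_uniq cV (_ ∘ f)).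
by rewrite [RHS]compA -lunitN -compA -tensmM compm1 comp1m.
Qed.

Lemma cart_fst_braid a b : fst b a ∘ braid MV a b = snd a b.
Proof.
rewrite /cart_fst -compA -braidN compA; congr (_ ∘ _).
by rewrite -lunit_braid -compA braidK compm1.
Qed.

Lemma cart_snd_braid a b : snd b a ∘ braid MV a b = fst a b.
Proof. by rewrite -cart_fst_braid -compA braidK compm1. Qed.

Definition diag a := pairing cV (id a) (id a).

Lemma tensm_diag a b c (f : hom a b) (g : hom a c) :
  (f ⊠ g) ∘ diag a = pairing cV f g.
Proof.
apply: (pairing_uniq (c0 := cV)); rewrite compA.
  by rewrite cart_fst_tensm -compA !cart_fst_pairing compm1.
by rewrite cart_snd_tensm -compA !cart_snd_pairing compm1.
Qed.

Lemma diagN a b (f : hom a b) : diag b ∘ f = (f ⊠ f) ∘ diag a.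
Proof.
rewrite tensm_diag; apply: (pairing_uniq (c0 := cV)); rewrite compA.
  by rewrite !cart_fst_pairing comp1m.
by rewrite !cart_snd_pairing comp1m.
Qed.

Lemma braid_diag a : braid MV a a ∘ diag a = diag a.
Proof.
apply: (pairing_uniq (c0 := cV)); rewrite compA.
  by rewrite cart_fst_braid cart_snd_pairing cart_fst_pairing.
by rewrite cart_snd_braid cart_snd_pairing cart_fst_pairing.
Qed.

Lemma pairing_eta a b c (f : hom a (tens MV b c)) :
  ((fst b c ∘ f) ⊠ (snd b c ∘ f)) ∘ diag a = f.
Proof.
rewrite tensm_diag.
by apply: (pairing_uniq (c0 := cV)); rewrite ?cart_fst_pairing ?cart_snd_pairing.
Qed.

End Cartesian.

Section Models.
Variables (V : category) (MV : sym_monoidal V) (cV : cartesian MV).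
Variables (A : category) (M : sym_monoidal A).
Variable Sg : strong_sym_monoidal_functor MV M.
Implicit Types a b c : A.
Local Notation "a ⊗ b" := (tens M a b) (at level 35, right associativity).
Local Notation "f ⊠ g" := (tensm M f g) (at level 35, right associativity).
Local Notation "f ⊠' g" := (tensm MV f g) (at level 35, right associativity).
Local Notation id := idm.
Local Notation "1" := (munit M).

(** A presentation of a as the image of an object of V.  It is data rather
    than a property, because the comonoid structure of a is read through it. *)
Record model a := Model { mob : V; miso : iso a (Sg mob) }.

Definition iso_id a : iso a a := Iso (comp1m (id a)) (comp1m (id a)).

Fact iso_comp_fwdK a b c (j : iso b c) (i : iso a b) :
  bwd i ∘ bwd j ∘ (j ∘ i) = id a.
Proof. by rewrite -compA (compA (bwd j)) fwdK comp1m fwdK. Qed.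
Fact iso_comp_bwdK a b c (j : iso b c) (i : iso a b) :
  j ∘ i ∘ (bwd i ∘ bwd j) = id c.
Proof. by rewrite -compA (compA i) bwdK comp1m bwdK. Qed.
Definition iso_comp a b c (j : iso b c) (i : iso a b) : iso a c :=
  Iso (iso_comp_fwdK j i) (iso_comp_bwdK j i).

Fact iso_tens_fwdK a a' b b' (i : iso a a') (j : iso b b') :
  (bwd i ⊠ bwd j) ∘ (i ⊠ j) = id (a ⊗ b).
Proof. by rewrite -tensmM !fwdK tensm1. Qed.
Fact iso_tens_bwdK a a' b b' (i : iso a a') (j : iso b b') :
  (i ⊠ j) ∘ (bwd i ⊠ bwd j) = id (a' ⊗ b').
Proof. by rewrite -tensmM !bwdK tensm1. Qed.
Definition iso_tens a a' b b' (i : iso a a') (j : iso b b') :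
    iso (a ⊗ b) (a' ⊗ b') :=
  Iso (iso_tens_fwdK i j) (iso_tens_bwdK i j).

Definition model_image (v : V) : model (Sg v) := Model (iso_id (Sg v)).
Definition model_unit : model 1 := Model (phi0 Sg).
Definition model_tens a b (ma : model a) (mb : model b) : model (a ⊗ b) :=
  Model (iso_comp (phi Sg _ _) (iso_tens (miso ma) (miso mb))).

(** The maps of A that come from V.  Realization is a functor that matches the
    whole symmetric monoidal structure of V with that of A, so an identity
    between structural maps of A may be proved in V, where maps into a tensor
    product are determined by their two projections. *)
Definition realize a b (ma : model a) (mb : model b)
    (h : hom (mob ma) (mob mb)) : hom a b :=
  bwd (miso mb) ∘ fmap Sg h ∘ miso ma.

Lemma realizeE a b (ma : model a) (mb : model b) (h : hom (mob ma) (mob mb))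
    (m : hom a b) :
  fmap Sg h ∘ miso ma = miso mb ∘ m -> realize h = m.
Proof. by rewrite /realize -compA => ->; rewrite compA fwdK comp1m. Qed.

Lemma realize1 a (ma : model a) : realize (id (mob ma)) = id a.
Proof. by apply: realizeE; rewrite fmap1 comp1m compm1. Qed.

Lemma realizeM a b c (ma : model a) (mb : model b) (mc : model c)
    (g : hom (mob mb) (mob mc)) (h : hom (mob ma) (mob mb)) :
  realize (g ∘ h) = realize g ∘ realize h :> hom a c.
Proof.
rewrite /realize fmapM -!compA; congr (_ ∘ (_ ∘ _)).
by rewrite (compA (miso mb)) bwdK comp1m.
Qed.

Lemma realize_tensm a a' b b' (ma : model a) (ma' : model a') (mb : model b)
    (mb' : model b') (h : hom (mob ma) (mob ma')) (k : hom (mob mb) (mob mb')) :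
  realize (ma := model_tens ma mb) (mb := model_tens ma' mb') (h ⊠' k)
  = realize h ⊠ realize k.
Proof.
apply: realizeE; rewrite /= compA phiN -!compA -!tensmM.
by rewrite /realize !compA !bwdK !comp1m.
Qed.

Lemma realize_assoc a b c (ma : model a) (mb : model b) (mc : model c) :
  realize (ma := model_tens (model_tens ma mb) mc)
    (mb := model_tens ma (model_tens mb mc)) (assoc MV _ _ _)
  = assoc M a b c.
Proof.
apply: realizeE; rewrite /=.
rewrite -{1}(comp1m (fwd (miso mc))) tensmM !compA phi_assoc -!compA assocN.
by rewrite -[X in _ = _ ∘ (X ⊠ _ ∘ _)]comp1m tensmM -!compA.
Qed.

Lemma realize_lunit a (ma : model a) :
  realize (ma := model_tens model_unit ma) (lunit MV _) = lunit M a.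
Proof. by apply: realizeE; rewrite /= tensm_l !compA phi_lunit lunitN. Qed.

Lemma realize_runit a (ma : model a) :
  realize (ma := model_tens ma model_unit) (runit MV _) = runit M a.
Proof. by apply: realizeE; rewrite /= tensm_r !compA phi_runit runitN. Qed.

Lemma realize_braid a b (ma : model a) (mb : model b) :
  realize (ma := model_tens ma mb) (mb := model_tens mb ma) (braid MV _ _)
  = braid M a b.
Proof. by apply: realizeE; rewrite /= !compA phi_braid -!compA braidN. Qed.

Definition representable a b (ma : model a) (mb : model b) (m : hom a b) :=
  exists h : hom (mob ma) (mob mb), m = realize h.

Lemma representable_id a (ma : model a) : representable ma ma (id a).
Proof. by exists (id _); rewrite realize1. Qed.

Lemma representable_comp a b c (ma : model a) (mb : model b) (mc : model c)
    (n : hom b c) (m : hom a b) :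
  representable mb mc n -> representable ma mb m ->
  representable ma mc (n ∘ m).
Proof. by move=> [h ->] [k ->]; exists (h ∘ k); rewrite realizeM. Qed.

Lemma representable_tensm a a' b b' (ma : model a) (ma' : model a')
    (mb : model b) (mb' : model b') (m : hom a a') (n : hom b b') :
  representable ma ma' m -> representable mb mb' n ->
  representable (model_tens ma mb) (model_tens ma' mb') (m ⊠ n).
Proof. by move=> [h ->] [k ->]; exists (h ⊠' k); rewrite realize_tensm. Qed.

Lemma representable_bwd a b (ma : model a) (mb : model b) (i : iso a b)
    (j : iso (mob ma) (mob mb)) :
  realize j = i -> representable mb ma (bwd i).
Proof.
move=> e; exists (bwd j); apply: (iso_monic (i := i)).
by rewrite -[in RHS]e -realizeM !bwdK realize1.
Qed.

Lemma representable_assocV a b c (ma : model a) (mb : model b) (mc : model c) :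
  representable (model_tens ma (model_tens mb mc))
    (model_tens (model_tens ma mb) mc) (bwd (assoc M a b c)).
Proof. exact/representable_bwd/realize_assoc. Qed.

Lemma representable_lunit a (ma : model a) :
  representable (model_tens model_unit ma) ma (lunit M a).
Proof. by exists (lunit MV _); rewrite realize_lunit. Qed.

Lemma representable_lunitV a (ma : model a) :
  representable ma (model_tens model_unit ma) (bwd (lunit M a)).
Proof. exact/representable_bwd/realize_lunit. Qed.

(** The comonoid structure of a: the image of the diagonal and of the map to
    the terminal unit. *)
Definition copy a (ma : model a) : hom a (a ⊗ a) :=
  realize (mb := model_tens ma ma) (diag cV (mob ma)).

Definition discard a (ma : model a) : hom a 1 :=
  realize (mb := model_unit) (bang cV (mob ma)).

Lemma copyN a b (ma : model a) (mb : model b) (m : hom a b) :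
  representable ma mb m -> copy mb ∘ m = (m ⊠ m) ∘ copy ma.
Proof. by move=> [h ->]; rewrite -realize_tensm -!realizeM diagN. Qed.

Lemma braid_copy a (ma : model a) : braid M a a ∘ copy ma = copy ma.
Proof. by rewrite -(realize_braid ma ma) -realizeM braid_diag. Qed.

Lemma discardN a b (ma : model a) (mb : model b) (m : hom a b) :
  representable ma mb m -> discard mb ∘ m = discard ma.
Proof.
by move=> [h ->]; rewrite -realizeM (bang_uniq cV (_ ∘ h)).
Qed.

(** In V, a map into a product is the pairing of its components; after
    realization, projecting onto a factor means discarding the other one. *)
Lemma representable_eta a b c (ma : model a) (mb : model b) (mc : model c)
    (m : hom a (b ⊗ c)) :
  representable ma (model_tens mb mc) m ->
  ((runit M b ∘ (id b ⊠ discard mc) ∘ m)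
     ⊠ (lunit M c ∘ (discard mb ⊠ id c) ∘ m)) ∘ copy ma = m.
Proof.
move=> [h ->]; rewrite -(realize_runit mb) -(realize_lunit mc).
rewrite -{1}(realize1 mb) -{1}(realize1 mc) -!realize_tensm -!realizeM.
by rewrite -realize_tensm -realizeM pairing_eta.
Qed.

End Models.

(** * The bar construction as a cocommutative coalgebra *)

Section Bar.
Variables (V : category) (MV : sym_monoidal V) (cV : cartesian MV).
Variables (A : abelian_category) (M : sym_monoidal A).
Variable Sg : strong_sym_monoidal_functor MV M.
Variable X : enriched_category MV.
Variable sums : forall k, coproduct (@bar V MV A M Sg X k).
Implicit Types x y z : X.
Local Notation "a ⊗ b" := (tens M a b) (at level 35, right associativity).
Local Notation "f ⊠ g" := (tensm M f g) (at level 35, right associativity).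
Local Notation id := idm.
Local Notation "1" := (munit M).
Local Notation tup := (tuple_of X).
Local Notation B k := (coprod (sums k)).
Local Notation "'ι' u" := (inj (sums _) u) (at level 10, u at level 9).
Local Notation face := (face cV sums).
Local Notation comult := (comult sums).
Local Notation face_from := (face_from cV).

Fixpoint bar_model (k : nat) :
    forall (x : X) (t : tup k), model Sg (bar_from Sg x t) :=
  match k with
  | 0 => fun _ _ => model_unit Sg
  | k'.+1 => fun x t =>
      model_tens (model_image Sg (ehom x (hd t))) (bar_model (hd t) (tl t))
  end.

Local Notation mdl u := (bar_model (hd u) (tl u)).

Lemma representable_erase x y :
  representable (model_image Sg (ehom x y)) (model_unit Sg) (erase cV Sg x y).
Proof. by exists (bang cV _); rewrite /realize /= compm1. Qed.

Lemma representable_compose x y z :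
  representable
    (model_tens (model_image Sg (ehom x y)) (model_image Sg (ehom y z)))
    (model_image Sg (ehom x z)) (compose Sg x y z).
Proof.
by exists (ecomp x y z); rewrite /realize /= comp1m tensm1 compm1.
Qed.

Lemma representable_erase_first k x (t : tup k.+1) :
  representable (bar_model x t) (mdl t) (erase_first cV Sg x t).
Proof.
apply: (representable_comp (representable_lunit _)).
exact: (representable_tensm (representable_erase _ _) (representable_id _)).
Qed.

Lemma representable_face_from k i x (t : tup k.+1) :
  representable (bar_model x t) (bar_model x (omit i t)) (face_from Sg i x t).
Proof.
elim: k i x t => [|k IH] i x t.
  apply: (representable_comp (representable_lunit _)).
  exact: (representable_tensm (representable_erase _ _) (representable_id _)).
case: i => [|i].
  apply: (representable_comp _ (representable_assocV _ _ _)).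
  exact: (representable_tensm (representable_compose _ _ _) (representable_id _)).
exact: (representable_tensm (representable_id _) (IH _ _ _)).
Qed.

Lemma representable_rebracket p q x (t : tup (p + q)) :
  representable (bar_model x t)
    (model_tens (bar_model x (front t)) (mdl (back x t))) (rebracket Sg x t).
Proof.
elim: p x t => [|p IH] x t; first exact: representable_lunitV.
apply: (representable_comp (representable_assocV _ _ _)).
exact: (representable_tensm (representable_id _) (IH _ _)).
Qed.

(** The shape under which the faces are used: each sends a summand to a single
    summand, by a map that comes from V. *)
Lemma face_summand k i (u : tup k.+2) :
  exists (w : tup k.+1) m,
    representable (mdl u) (mdl w) m /\ face k i ∘ ι u = ι w ∘ m.
Proof.
case: i => [|i].
  exists (tl u), (erase_first cV Sg (hd u) (tl u)).
  by split; [exact: representable_erase_first | exact: face0E].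
exists (hd u, omit i (tl u)), (face_from Sg i (hd u) (tl u)).
by split; [exact: representable_face_from | exact: faceSE].
Qed.

Definition bar_copy k : hom (B k) (B k ⊗ B k) :=
  copair (sums k) (fun u => (ι u ⊠ ι u) ∘ copy cV (mdl u)).

Definition bar_discard k : hom (B k) 1 :=
  copair (sums k) (fun u => discard cV (mdl u)).

Lemma bar_copyE k (u : tup k.+1) :
  bar_copy k ∘ ι u = (ι u ⊠ ι u) ∘ copy cV (mdl u).
Proof. exact: copair_inj. Qed.

Lemma bar_discardE k (u : tup k.+1) : bar_discard k ∘ ι u = discard cV (mdl u).
Proof. exact: copair_inj. Qed.

Lemma bar_copy_face k i :
  bar_copy k ∘ face k i = (face k i ⊠ face k i) ∘ bar_copy k.+1.
Proof.
apply: (@copair_uniq _ _ _ (sums k.+1)) => u.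
have [w [m [mR e]]] := face_summand i u.
rewrite -!compA bar_copyE [RHS]compA -tensmM e [LHS]compA bar_copyE tensmM.
by rewrite -[LHS]compA -[RHS]compA (copyN _ mR).
Qed.

Lemma bar_discard_face k i : bar_discard k ∘ face k i = bar_discard k.+1.
Proof.
apply: (@copair_uniq _ _ _ (sums k.+1)) => u.
have [w [m [mR e]]] := face_summand i u.
by rewrite -compA e compA !bar_discardE (discardN _ mR).
Qed.

Lemma braid_bar_copy k : braid M (B k) (B k) ∘ bar_copy k = bar_copy k.
Proof.
apply: (@copair_uniq _ _ _ (sums k)) => u.
by rewrite -compA bar_copyE compA braidN -compA braid_copy.
Qed.

(** The front p-face and the back q-face of a (p+q)-simplex, obtained from the
    coproduct by discarding the other factor.  In this form their behaviour
    with respect to faces follows from that of the coproduct. *)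
Definition front_map p q : hom (B (p + q)%N) (B p) :=
  runit M _ ∘ (id _ ⊠ bar_discard q) ∘ comult p q.

Definition back_map p q : hom (B (p + q)%N) (B q) :=
  lunit M _ ∘ (bar_discard p ⊠ id _) ∘ comult p q.

Lemma front_mapE p q (u : tup (p + q).+1) :
  front_map p q ∘ ι u
  = ι ((hd u, front (tl u)) : tup p.+1)
    ∘ (runit M _ ∘ (id _ ⊠ discard cV (mdl (back (hd u) (tl u))))
       ∘ rebracket Sg (hd u) (tl u)).
Proof.
rewrite /front_map -[LHS]compA comultE !compA; congr (_ ∘ _).
rewrite -[LHS]compA -tensmM comp1m bar_discardE tensm_l compA runitN.
by rewrite -!compA.
Qed.

Lemma back_mapE p q (u : tup (p + q).+1) :
  back_map p q ∘ ι u
  = ι (back (hd u) (tl u))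
    ∘ (lunit M _ ∘ (discard cV (bar_model (hd u) (front (tl u))) ⊠ id _)
       ∘ rebracket Sg (hd u) (tl u)).
Proof.
rewrite /back_map -[LHS]compA comultE !compA; congr (_ ∘ _).
rewrite -[LHS]compA -tensmM comp1m (@bar_discardE p) tensm_r compA lunitN.
by rewrite -!compA.
Qed.

(** The coproduct is the Alexander-Whitney map of the coalgebra B, because on
    each summand rebracketing comes from V and is determined by its two
    components. *)
Lemma comult_front_back p q :
  comult p q = (front_map p q ⊠ back_map p q) ∘ bar_copy (p + q).
Proof.
apply: (@copair_uniq _ _ _ (sums (p + q)%N)) => u.
rewrite comultE -[RHS]compA bar_copyE [RHS]compA -tensmM front_mapE back_mapE.
rewrite tensmM -compA; congr (_ ∘ _).
by rewrite (representable_eta _ (representable_rebracket (hd u) (tl u))).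
Qed.

(** The recursion that defines the faces treats an index beyond the last one as
    the last one.  The simplicial identities thus hold for all i <= j, with no
    bound that depends on the degree. *)
Lemma face_clip k i : (k < i)%N -> face k i = face k k.+1.
Proof.
case: i => // i; rewrite ltnS => ki.
apply: (@copair_uniq _ _ _ (sums k.+1)) => u; rewrite !faceSE.
have h x (t : tup k.+1) :
    existT (fun t' => hom (bar_from Sg x t) (bar_from Sg x t'))
      (omit i t) (face_from Sg i x t)
    = existT (fun t' => hom (bar_from Sg x t) (bar_from Sg x t'))
      (omit k t) (face_from Sg k x t).
  elim: k i ki x t {u} => [|k IH] [|i] // ki x t /=.
  pose G (o : {t' : tup k &
      hom (bar_from Sg (hd t) (tl t)) (bar_from Sg (hd t) t')})
    := existT (fun t' => hom (bar_from Sg x t) (bar_from Sg x t'))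
       ((hd t, projT1 o) : tup k.+1) (id (Sg (ehom x (hd t))) ⊠ projT2 o).
  exact: (congr1 G (IH i ki (hd t) (tl t))).
pose G (o : {t' : tup k & hom (bar Sg u) (bar_from Sg (hd u) t')})
  := ι ((hd u, projT1 o) : tup k.+1) ∘ projT2 o.
exact: (congr1 G (h (hd u) (tl u))).
Qed.

Lemma front_map_face p q :
  front_map p q ∘ face (p + q) (p + q).+1
  = front_map p q.+1 ∘ deg_cast (fun k => B k) (esym (addnS p q)).
Proof.
have h := comult_face_back cV sums (esym (addnS p q)) (leqnn q).
rewrite (face_clip (i := (p + q.+1)%N)) in h; last by rewrite addnS.
rewrite /front_map -[LHS]compA h -[X in _ ∘ X]compA [LHS]compA.
rewrite -[X in X ∘ _ = _]compA -tensmMr bar_discard_face.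
by rewrite -[RHS]compA.
Qed.

Lemma back_map_face p q :
  back_map p q ∘ face (p + q) 0 = back_map p.+1 q.
Proof.
rewrite /back_map -!compA (@comult_face_front _ _ _ _ _ _ _ _ p q 0) //.
by rewrite (compA (bar_discard p ⊠ _)) -tensmMl bar_discard_face.
Qed.

Lemma discard_unit : discard cV (model_unit Sg) = id 1.
Proof.
by rewrite /discard -(bang_uniq cV (id _)) realize1.
Qed.

Lemma back_map0 q : back_map 0 q = id (B q).
Proof.
apply: (@copair_uniq _ _ _ (sums q)) => u; rewrite (@back_mapE 0 q) comp1m /=.
by rewrite discard_unit tensm1 compm1 bwdK compm1; case: u.
Qed.

(** Discarding the empty tail after rebracketing changes nothing.  The indices
    p and p + 0 are not convertible, so the statement compares a summand
    together with a map into it. *)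
Lemma front_cast p (e : p = (p + 0)%N) x (t : tup p) :
  existT (fun t' => hom (bar_from Sg x t) (bar_from Sg x t'))
    (front (projT1 (cast_out Sg e x t)))
    (runit M _
       ∘ (id _ ⊠ discard cV (mdl (back x (projT1 (cast_out Sg e x t)))))
       ∘ rebracket Sg x (projT1 (cast_out Sg e x t))
       ∘ projT2 (cast_out Sg e x t))
  = existT (fun t' => hom (bar_from Sg x t) (bar_from Sg x t')) t (id _).
Proof.
elim: p e x t => [|p IH] e x t.
  rewrite (eq_irrelevance e erefl) /=; case: t; congr (existT _ _ _).
  by rewrite discard_unit tensm1 !compm1 -lunit_unit bwdK.
have e' : p = (p + 0)%N by rewrite addn0.
have -> : e = congr1 succn e' by exact: eq_irrelevance.
case: t => y t; rewrite cast_out_cons.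
pose G (o : {t' : tup p & hom (bar_from Sg y t) (bar_from Sg y t')})
  := existT (fun t' => hom (bar_from Sg x ((y, t) : tup p.+1)) (bar_from Sg x t'))
       ((y, projT1 o) : tup p.+1) (id (Sg (ehom x y)) ⊠ projT2 o).
have := congr1 G (IH e' y t).
rewrite /G /= tensm1 => h; apply: etrans h; congr (existT _ _ _).
move: (discard _ _) => D.
rewrite !tensmMr -runit_tensV -!compA; congr (_ ∘ _).
by rewrite (compA (bwd _)) assocNV tensm1 -!compA.
Qed.

Lemma front_map0 p :
  front_map p 0 = deg_cast (fun k => B k) (addn0 p).
Proof.
have e := esym (addn0 p).
suff h : front_map p 0 ∘ deg_cast (fun k => B k) e = id _.
  rewrite -[LHS]compm1 -[RHS]comp1m -h -compA; congr (_ ∘ _).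
  rewrite (eq_irrelevance (addn0 p) (esym e)).
  by case: _ / e {h} => /=; rewrite comp1m.
apply: (@copair_uniq _ _ _ (sums p)) => u.
rewrite -compA deg_castE [LHS]compA front_mapE comp1m.
pose G (o : {t' : tup p & hom (bar Sg u) (bar_from Sg (hd u) t')})
  := ι ((hd u, projT1 o) : tup p.+1) ∘ projT2 o.
have := congr1 G (front_cast e (hd u) (tl u)).
by rewrite /G /= compm1 -!compA => -> {G}; case: u.
Qed.

Lemma face_face_clip k i j : (i <= j)%N ->
  face k i ∘ face k.+1 j.+1 = face k j ∘ face k.+1 i.
Proof.
move=> ij; case: (leqP j k.+1) => [jk|kj]; first by rewrite face_face ?ij.
rewrite (face_clip (leqW kj)) (face_clip (ltnW kj)).
case: (leqP i k.+1) => [ik|ki]; first by rewrite face_face // ik /=.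
by rewrite (face_clip (ltnW ki)) (face_clip ki).
Qed.

End Bar.

(** * Cup-1 products *)

(** An abelian group with the cofaces of a cosimplicial group whose degrees have
    been put together, which makes all composites of cofaces typed without
    identification of degrees.  The coface [cof_last] is the one with the
    highest index in each degree. *)
Record coface_group := CofaceGroup {
  cof_sort :> zmodType;
  cof : nat -> {additive cof_sort -> cof_sort};
  cof_last : {additive cof_sort -> cof_sort};
  cof_cof : forall i j x, (i <= j)%N -> cof j.+1 (cof i x) = cof i (cof j x);
  cof_last_cof : forall i x, cof_last (cof i x) = cof i (cof_last x)
}.

Section Cofaces.
Variable C : coface_group.
Implicit Types x : C.
Local Notation d := (@cof C).
Local Notation e := (@cof_last C).

(** The cosimplicial identities for the omission of m consecutive vertices from
    j on, according to the position of a further omitted vertex i: before them,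
    adjacent to them, or after them. *)
Lemma cof_iter_low i j m x : (i <= j)%N ->
  d i (iter m (d j) x) = iter m (d j.+1) (d i x).
Proof. by move=> ij; elim: m => //= m <-; rewrite cof_cof. Qed.

Lemma cof_iter_mid i j m x : (j <= i <= j + m)%N ->
  d i (iter m (d j) x) = iter m.+1 (d j) x.
Proof.
elim: m i => [|m IH] i /andP[ji im].
  by have -> : i = j by lia.
case: (eqVneq i j) => [-> //|ne].
have -> : i = i.-1.+1 by lia.
rewrite [in LHS]iterS cof_cof ?IH //; lia.
Qed.

Lemma cof_iter_high i j m x : (j <= i)%N ->
  d (i + m) (iter m (d j) x) = iter m (d j) (d i x).
Proof.
move=> ji; elim: m => [|m IH]; first by rewrite addn0.
rewrite addnS iterS cof_cof ?IH //; lia.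
Qed.

Lemma cof_iter_last i m x : d i (iter m e x) = iter m e (d i x).
Proof. by elim: m => //= m <-; rewrite cof_last_cof. Qed.

(** A coface of an element of degree n has indices up to n + 1; beyond that, it
    is clipped to the last one. *)
Definition has_degree n x := forall i, (n < i)%N -> d i x = e x.

Definition coboundary n x := \sum_(0 <= i < n.+2) d i x *~ (-1) ^+ i.

Lemma cof_iter_degree n m x :
  has_degree n x -> iter m (d n.+1) x = iter m e x.
Proof.
move=> dx; elim: m => //= m ->.
by rewrite cof_iter_last dx // -iterSr.
Qed.

End Cofaces.

Lemma zmod_morphism_sumz (C D : zmodType) (u : C -> D) (uZ : zmod_morphism u)
    I (r : seq I) (F : I -> C) (s : I -> int) :
  u (\sum_(i <- r) F i *~ s i) = \sum_(i <- r) u (F i) *~ s i.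
Proof.
pose v : {additive C -> D} := HB.pack u (GRing.isZmodMorphism.Build _ _ u uZ).
rewrite -[u]/(v : C -> D) raddf_sum; apply: eq_bigr => i _.
by rewrite raddfMz.
Qed.

Lemma iter_zmod_morphism (C : zmodType) (u : {additive C -> C}) m :
  zmod_morphism (iter m u).
Proof. by move=> x y; elim: m => //= m ->; rewrite raddfB. Qed.

Lemma mulrz_sign (C : zmodType) (x : C) n :
  x *~ (-1) ^+ n = if odd n then - x else x.
Proof. by rewrite -signr_odd; case: odd; rewrite ?mulrN1z ?mulr1z. Qed.

Section CupOne.
Variables (F G E : coface_group) (P : F -> G -> E).
Hypothesis PDl : forall y, zmod_morphism (P^~ y).
Hypothesis PDr : forall x, zmod_morphism (P x).
Hypothesis P_cof : forall i x y, P (cof _ i x) (cof _ i y) = cof _ i (P x y).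

Let Psuml I (s : seq I) (H : I -> F) (c : I -> int) y :
  P (\sum_(i <- s) H i *~ c i) y = \sum_(i <- s) P (H i) y *~ c i.
Proof. exact: (zmod_morphism_sumz (PDl y)). Qed.
Let Psumr I (s : seq I) (H : I -> G) (c : I -> int) x :
  P x (\sum_(i <- s) H i *~ c i) = \sum_(i <- s) P x (H i) *~ c i.
Proof. exact: (zmod_morphism_sumz (PDr x)). Qed.
Let P0l y : P 0 y = 0.
Proof. by rewrite -(subrr 0) PDl subrr. Qed.
Let P0r x : P x 0 = 0.
Proof. by rewrite -(subrr 0) PDr subrr. Qed.
Let iter_sum (C : zmodType) (u : {additive C -> C}) m :=
  zmod_morphism_sumz (iter_zmod_morphism u m).
Let iter0 (C : zmodType) (u : {additive C -> C}) m : iter m u 0 = 0.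
Proof. by elim: m => //= m ->; rewrite raddf0. Qed.

Section Cocycles.
Variables (p q : nat) (f : F) (g : G).
Hypothesis gq : has_degree q g.
Hypotheses (df : coboundary p f = 0) (dg : coboundary q g = 0).
Local Notation eF := (@cof_last F).
Local Notation eG := (@cof_last G).
Local Notation dF := (@cof F).
Local Notation dG := (@cof G).
Local Notation dE := (@cof E).

(* Q 0 and R p are the two products to be compared; for j between 0 and p, the
   pairs Q j and R j interpolate between them. *)
Let Q j := P (iter q (dF j) f) (iter j (dG 0) (iter (p - j) eG g)).
Let R j := P (iter q (dF j.+1) f) (iter j (dG 0) (iter (p - j) eG g)).

Variable r : nat.
Hypothesis qr : q = r.+1.
(* T j is the j-th term of the cup-1 product: f sees the vertices 0, ..., j and
   j + q, ..., p + q - 1, and g sees j, ..., j + q.  U j i is what T j becomes,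
   one degree higher, when f is replaced by its i-th coface. *)
Let T j := P (iter r (dF j.+1) f) (iter j (dG 0) (iter (p - j.+1) eG g)).
Let U j i := P (iter r (dF j.+1) (dF i f)) (iter j (dG 0) (iter (p - j) eG g)).

Let sum_U j : \sum_(0 <= i < p.+2) U j i *~ (-1) ^+ i = 0.
Proof.
transitivity (P (iter r (dF j.+1) (coboundary p f))
  (iter j (dG 0) (iter (p - j) eG g))).
  by rewrite iter_sum Psuml.
by rewrite df iter0 P0l.
Qed.

Let UQ j : U j j = Q j.
Proof. by rewrite /U /Q qr -cof_iter_low. Qed.
Let UR j : U j j.+1 = R j.
Proof. by rewrite /U /R qr iterSr. Qed.

(* The faces d_i of T j, for i <= j, for j < i <= j + q and for j + q < i. *)
Let low j i : (j < p)%N -> (i <= j)%N -> dE i (T j) = U j.+1 i.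
Proof.
move=> jp ij; rewrite -P_cof /U cof_iter_low 1?ltnW //.
by rewrite cof_iter_mid.
Qed.

(* The analogue of U for the cofaces of g. *)
Let V j k :=
  P (iter q (dF j.+1) f) (iter j (dG 0) (iter (p - j.+1) eG (dG k g))).

Let mid j k : (j < p)%N -> (0 < k <= q)%N -> dE (k + j) (T j) = V j k.
Proof.
move=> jp kq; rewrite -P_cof cof_iter_mid; last by lia.
by rewrite -qr cof_iter_high // cof_iter_last.
Qed.

Let high j i : (j < p)%N -> (j.+2 <= i)%N -> dE (i + r) (T j) = U j i.
Proof.
move=> jp ji; rewrite -P_cof cof_iter_high 1?ltnW // /U.
have -> : (i + r = (i + r - j) + j)%N by lia.
rewrite cof_iter_high // cof_iter_last gq; last by lia.
by rewrite -iterSr subnSK.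
Qed.

(* As g is a cocycle, the sum of its inner faces is given by the two outer
   ones. *)
Let sum_V j : (j < p)%N ->
  \sum_(1 <= k < q.+1) V j k *~ (-1) ^+ k = R j *~ (-1) ^+ q - Q j.+1.
Proof.
move=> jp.
have : \sum_(0 <= k < q.+2) V j k *~ (-1) ^+ k = 0.
  transitivity (P (iter q (dF j.+1) f)
    (iter j (dG 0) (iter (p - j.+1) eG (coboundary q g)))).
    by rewrite !iter_sum Psumr.
  by rewrite dg !iter0 P0r.
rewrite big_nat_recr //= big_ltn // expr0 mulr1z.
have -> : V j 0 = Q j.+1 by rewrite /V -cof_iter_last -iterSr.
have -> : V j q.+1 = R j.
  by rewrite /V gq // -iterSr /R subnSK.
rewrite exprS mulN1r mulrNz => /eqP; rewrite subr_eq0 addrC => /eqP <-.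
by rewrite addrK.
Qed.

(* For a fixed j, the coboundary of f lacks the faces j and j + 1, that is, Q j
   and R j; the low faces W j come from T (j - 1) and the high ones Y j from
   T j. *)
Let W j := \sum_(0 <= i < j) U j i *~ (-1) ^+ i.
Let Y j := \sum_(j.+2 <= i < p.+2) U j i *~ (-1) ^+ i.

Let WY j : (j <= p)%N -> W j + Y j = (R j - Q j) *~ (-1) ^+ j.
Proof.
move=> jp; have := sum_U j.
rewrite (@big_cat_nat _ _ _ j) //=; last by lia.
rewrite (@big_ltn _ _ _ j); last by lia.
rewrite (@big_ltn _ _ _ j.+1); last by lia.
rewrite UQ UR exprS mulN1r mulrNz -/(W j) -/(Y j) => e.
apply/eqP; rewrite -subr_eq0 mulrzBl opprB addrACA (addrC (Y j)).
by rewrite -[_ + _ + _]addrA e.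
Qed.

Let dT j : (j < p)%N ->
  \sum_(0 <= i < (p + q).+1) dE i (T j) *~ (-1) ^+ i
  = W j.+1 + (R j *~ (-1) ^+ q - Q j.+1) *~ (-1) ^+ j + Y j *~ (-1) ^+ r.
Proof.
move=> jp.
rewrite (@big_cat_nat _ _ _ j.+1) //=; last by lia.
rewrite (@big_cat_nat _ _ _ (j.+1 + q)%N j.+1) //=; try lia.
rewrite addrA; congr (_ + _ + _).
- rewrite /W; apply: eq_big_nat => i /andP[_ ij]; rewrite low //; lia.
- have -> : (j.+1 + q = q.+1 + j)%N by lia.
  rewrite -sum_V // -{1}[j.+1]add1n big_addn addnK mulrz_suml.
  by apply: eq_big_nat => k kq; rewrite mid // -mulrzA exprD.
have -> : (j.+1 + q = j.+2 + r)%N by lia.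
have -> : ((p + q).+1 = p.+2 + r)%N by lia.
rewrite big_addn addnK /Y mulrz_suml.
by apply: eq_big_nat => k kq; rewrite high -1?mulrzA ?exprD //; lia.
Qed.

(** The case of positive q = r + 1; the terms T j omit q - 1 vertices, which
    makes no sense for q = 0. *)
Lemma cup1_pos :
  exists h : E, \sum_(0 <= i < (p + q).+1) dE i h *~ (-1) ^+ i
    = (Q 0 - R p *~ (-1) ^+ (p * q)) *~ (-1) ^+ q.
Proof.
(* These signs make the low faces of T j and the high faces of T (j + 1) add up
   to a coboundary of f. *)
exists (\sum_(0 <= j < p) T j *~ (-1) ^+ (j * r)).
transitivity (\sum_(0 <= j < p)
   (\sum_(0 <= i < (p + q).+1) dE i (T j) *~ (-1) ^+ i) *~ (-1) ^+ (j * r)).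
  under eq_bigr => i _ do rewrite raddf_sum mulrz_suml.
  rewrite exchange_big; apply: eq_bigr => j _; rewrite mulrz_suml.
  by apply: eq_bigr => i _; rewrite raddfMz -!mulrzA mulrC.
(* Substituting for Y leaves a telescoping sum, whose end t p is R p up to sign
   because Y p = 0. *)
pose t j := W j *~ (-1) ^+ (j.+1 * r) - Q j *~ (-1) ^+ (j.+1 * q).
transitivity (\sum_(0 <= j < p) (t j.+1 - t j)).
  apply: eq_big_nat => j jp; rewrite dT //.
  have -> : Y j = (R j - Q j) *~ (-1) ^+ j - W j.
    by rewrite -WY 1?ltnW // addrC addrA addNr add0r.
  rewrite /t qr !mulSn mulnS !mulrz_sign !(oddD, oddM, oddS).
  case: (odd j); case: (odd r) => /=; rewrite ?(opprD, opprK) !addrA;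
    rewrite [LHS](ACl ((2*4)*1*3*6*5)) /= ?(addNr, subrr) add0r //.
rewrite telescope_sumr // /t mul1n.
have -> : W 0 = 0 by rewrite /W big_nil.
have -> : W p = (R p - Q p) *~ (-1) ^+ p.
  by rewrite -WY // /Y big_geq // addr0.
rewrite mul0rz !sub0r opprK qr !mulSn mul0n addn0 mulnS.
rewrite !mulrz_sign !(oddD, oddM, oddS).
by case: (odd p); case: (odd r);
  rewrite /= ?(opprD, opprK) ?(addrK, subrK) // addrC.
Qed.

End Cocycles.

(** Steenrod's identity.  When q = 0 there is no cup-1 product, but a cocycle g
    of degree 0 satisfies d_0 g = d_1 g, so the two products are equal. *)
Lemma cup1 p q f g :
  has_degree p f -> has_degree q g ->
  coboundary p f = 0 -> coboundary q g = 0 ->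
  exists h : E, \sum_(0 <= i < (p + q).+1) cof E i h *~ (-1) ^+ i
    = (P (iter q (cof F 0) f) (iter p (cof_last G) g)
       - P (iter q (cof_last F) f) (iter p (cof G 0) g) *~ (-1) ^+ (p * q))
      *~ (-1) ^+ q.
Proof.
move=> fp gq df dg; case: q gq dg => [|r] gq dg.
  exists 0; rewrite muln0 expr0 mulr1z /=.
  have ge : cof G 0 g = cof_last G g.
    move: dg; rewrite /coboundary big_nat_recr //= big_nat1 expr0 expr1 mulr1z.
    by rewrite mulrN1z (gq 1%N) // => /eqP; rewrite subr_eq0 => /eqP.
  have -> : iter p (cof G 0) g = iter p (cof_last G) g.
    by elim: p {fp df} => //= m ->; rewrite cof_iter_last ge -iterSr.
  by rewrite subrr big1 // => i _; rewrite raddf0 mul0rz.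
have [h e] := cup1_pos gq df dg erefl.
by exists h; rewrite e subn0 subnn (cof_iter_degree _ fp).
Qed.

End CupOne.

(** * Families of cochains *)

(** Clipping the index of a coface frees the cosimplicial identities from any
    bound that depends on the degree, so that they hold for families in which
    all degrees occur together. *)
Record cosemisimplicial (C : category) := Cosemisimplicial {
  cs_ob :> nat -> C;
  coface : forall n, nat -> hom (cs_ob n) (cs_ob n.+1);
  coface_coface : forall n i j, (i <= j)%N ->
    coface n.+1 j.+1 ∘ coface n i = coface n.+1 i ∘ coface n j;
  coface_clip : forall n i, (n < i)%N -> coface n i = coface n n.+1
}.
Arguments coface {C} _ n i.

(** A generalized element of K in every degree at once, so that a coface acts on
    families without change of type. *)
Definition family (C : preadditive) (K : nat -> C) (Z : C) :=
  forall n, hom Z (K n).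

Section FamilyZmodule.
Variables (C : preadditive) (K : nat -> C) (Z : C).
Local Notation T := (family K Z).

Lemma familyP (x y : T) : (forall n, x n = y n) -> x = y.
Proof. exact: functional_extensionality_dep. Qed.

Definition family_add (x y : T) : T := fun n => x n + y n.
Definition family_zero : T := fun n => 0.
Definition family_opp (x : T) : T := fun n => - x n.

Fact family_addA : associative family_add.
Proof. by move=> x y z; apply: familyP => n; apply: addrA. Qed.
Fact family_addC : commutative family_add.
Proof. by move=> x y; apply: familyP => n; apply: addrC. Qed.
Fact family_add0 : left_id family_zero family_add.
Proof. by move=> x; apply: familyP => n; apply: add0r. Qed.
Fact family_addN : left_inverse family_zero family_opp family_add.
Proof. by move=> x; apply: familyP => n; apply: addNr. Qed.

HB.instance Definition _ := gen_eqMixin T.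
HB.instance Definition _ := gen_choiceMixin T.
HB.instance Definition _ := GRing.isZmodule.Build T
  family_addA family_addC family_add0 family_addN.

Lemma familyB (x y : T) n : (x - y) n = x n - y n.
Proof. by []. Qed.

Lemma family_sumE I (r : seq I) (F : I -> T) (c : I -> int) n :
  (\sum_(i <- r) F i *~ c i) n = \sum_(i <- r) F i n *~ c i.
Proof.
exact: (@zmod_morphism_sumz T _ (fun x : T => x n) (fun x y => familyB x y n)).
Qed.

Lemma familyMz (x : T) (c : int) n : (x *~ c) n = x n *~ c.
Proof.
by have := family_sumE [:: tt] (fun=> x) (fun=> c) n; rewrite !big_seq1.
Qed.

Definition single p (x : hom Z (K p)) : T :=
  fun n => if p =P n is ReflectT e then deg_cast K e ∘ x else 0.

Lemma singleE p (x : hom Z (K p)) : single x p = x.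
Proof.
rewrite /single; case: eqP => // e.
by rewrite (eq_irrelevance e erefl) /deg_cast /= comp1m.
Qed.

Lemma single_neq p n (x : hom Z (K p)) : p != n -> single x n = 0.
Proof. by rewrite /single; case: eqP. Qed.

End FamilyZmodule.

Section FamilyCofaces.
Variables (C : preadditive) (K : cosemisimplicial C) (Z : C).
Local Notation T := (family K Z).

(** The action of a family of coface maps, which shifts degrees by one; nothing
    arrives in degree 0. *)
Definition raise (d : forall n, hom (K n) (K n.+1)) (x : T) : T :=
  fun n => match n with 0 => 0 | m.+1 => d m ∘ x m end.

Fact raise_is_zmod_morphism d : zmod_morphism (raise d).
Proof.
move=> x y; apply: familyP => -[|n]; first by rewrite familyB subr0.
by rewrite familyB /= familyB compBr.
Qed.

HB.instance Definition _ d :=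
  GRing.isZmodMorphism.Build T T (raise d) (raise_is_zmod_morphism d).

Fact raise_coface i j (x : T) : (i <= j)%N ->
  raise (coface K ^~ j.+1) (raise (coface K ^~ i) x)
  = raise (coface K ^~ i) (raise (coface K ^~ j) x).
Proof.
move=> ij; apply: familyP => -[|[|n]] //=; first by rewrite !comp0r.
by rewrite !compA coface_coface.
Qed.

Fact raise_last i (x : T) :
  raise (fun n => coface K n n.+1) (raise (coface K ^~ i) x)
  = raise (coface K ^~ i) (raise (fun n => coface K n n.+1) x).
Proof.
apply: familyP => -[|[|n]] //=; first by rewrite !comp0r.
rewrite !compA; congr (_ ∘ _); case: (leqP i n.+1) => [|ni].
  exact: coface_coface.
by rewrite (coface_clip _ ni) (coface_clip _ (ltnW ni)).
Qed.

Definition family_cofaces : coface_group := CofaceGroup raise_coface raise_last.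

Local Notation d0 := (raise (coface K ^~ 0%N)).
Local Notation dl := (raise (fun n => coface K n n.+1)).

Lemma single_degree p (x : hom Z (K p)) :
  @has_degree family_cofaces p (single x).
Proof.
move=> i pi; apply: familyP => -[|n] //=.
have [<-|pn] := eqVneq p n; first by rewrite coface_clip.
by rewrite single_neq // !comp0r.
Qed.

Lemma single_coboundary p (x : hom Z (K p)) :
  \sum_(i < p.+2) (coface K p i ∘ x) *~ (-1) ^+ i = 0 ->
  @coboundary family_cofaces p (single x) = 0.
Proof.
move=> dx; apply: familyP => n; rewrite /coboundary family_sumE.
case: n => [|n]; first by rewrite big1 // => i _; rewrite /= mul0rz.
have [<-|pn] := eqVneq p n.
  by rewrite -[RHS]dx big_mkord; apply: eq_bigr => i _ /=; rewrite singleE.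
by rewrite big1 // => i _; rewrite /= single_neq // comp0r mul0rz.
Qed.

(** [iter_d0E] and [iter_dlE] compute iterated first and last cofaces by any
    maps B and F that satisfy the same recursion.  Adding q on the right is not
    a definitional recursion, whence the degree casts for F. *)
Lemma iter_d0E p q (B : forall p q, hom (K q) (K (p + q)%N)) (x : T) :
  (forall q, B 0 q = idm (K q)) ->
  (forall p q, B p.+1 q = coface K (p + q) 0 ∘ B p q) ->
  iter p d0 x (p + q)%N = B p q ∘ x q.
Proof.
move=> B0 BS; elim: p => [|p IH]; first by rewrite B0 comp1m.
by rewrite iterS /= IH compA BS.
Qed.

Lemma iter_dlE p q (F : forall p q, hom (K p) (K (p + q)%N)) (x : T) :
  (forall p, F p 0 = deg_cast K (esym (addn0 p))) ->
  (forall p q, coface K (p + q) (p + q).+1 ∘ F p q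
     = deg_cast K (addnS p q) ∘ F p q.+1) ->
  iter q dl x (p + q)%N = F p q ∘ x p.
Proof.
move=> F0 FS.
suff h n (e : (p + q)%N = n) : iter q dl x n = deg_cast K e ∘ (F p q ∘ x p).
  by rewrite (h _ erefl) comp1m.
elim: q n e => [|q IH] n e.
  rewrite F0 /=; case: n / e.
  by case: _ / (esym (addn0 p)); rewrite /deg_cast /= !comp1m.
have e' : n = (p + q).+1 by rewrite -addnS.
case: _ / (esym e') e => e.
rewrite iterS /= (IH _ erefl) comp1m !compA FS.
by rewrite (eq_irrelevance e (addnS p q)).
Qed.

End FamilyCofaces.

Section FamilyProduct.
Variables (A : abelian_category) (M : sym_monoidal A) (cl : monoidal_closed M).
Variable K : cosemisimplicial A.
Local Notation "f ⊠ g" := (tensm M f g) (at level 35, right associativity).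
Local Notation d0 := (raise (coface K ^~ 0%N)).
Local Notation dl := (raise (fun n => coface K n n.+1)).
Variable mu : forall n, hom (tens M (K n) (K n)) (K n).
Hypothesis mu_coface : forall n i,
  mu n.+1 ∘ (coface K n i ⊠ coface K n i) = coface K n i ∘ mu n.
Variables Z W : A.

Definition family_mul (x : family K Z) (y : family K W) :
    family K (tens M Z W) :=
  fun n => mu n ∘ (x n ⊠ y n).

Fact family_mulBl y : zmod_morphism (family_mul ^~ y).
Proof.
move=> x x'; apply: familyP => n; rewrite familyB /family_mul familyB.
rewrite (tensm_l _ (x n - _)) (tensm_l _ (x n)) (tensm_l _ (x' n)).
have := tensml_is_zmod_morphism cl (K n) (x n) (x' n); rewrite /tensml => ->.
by rewrite compBl compBr.
Qed.

Fact family_mulBr x : zmod_morphism (family_mul x).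
Proof.
move=> y y'; apply: familyP => n; rewrite familyB /family_mul familyB.
rewrite (tensm_r _ _ (y n - _)) (tensm_r _ _ (y n)) (tensm_r _ _ (y' n)).
have := tensmr_is_zmod_morphism cl (K n) (y n) (y' n); rewrite /tensmr => ->.
by rewrite compBl compBr.
Qed.

Fact family_mul_coface i x y :
  family_mul (raise (coface K ^~ i) x) (raise (coface K ^~ i) y)
  = raise (coface K ^~ i) (family_mul x y).
Proof.
apply: familyP => -[|n]; rewrite /family_mul /=.
  by rewrite (tensm_l _ 0) (tensm0l cl) comp0l comp0r.
by rewrite tensmM !compA mu_coface.
Qed.

Lemma cup1_family p q (x : hom Z (K p)) (y : hom W (K q)) :
  \sum_(i < p.+2) (coface K p i ∘ x) *~ (-1) ^+ i = 0 ->
  \sum_(i < q.+2) (coface K q i ∘ y) *~ (-1) ^+ i = 0 ->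
  exists h : family K (tens M Z W),
    family_mul (iter q d0 (single x)) (iter p dl (single y)) (p + q)%N
    - family_mul (iter q dl (single x)) (iter p d0 (single y)) (p + q)%N
      *~ (-1) ^+ (p * q)
    = \sum_(0 <= i < (p + q).+1) raise (coface K ^~ i) h (p + q)%N *~ (-1) ^+ i.
Proof.
move=> dx dy.
have [h e] := @cup1 (family_cofaces K Z) (family_cofaces K W)
  (family_cofaces K (tens M Z W)) family_mul family_mulBl family_mulBr
  family_mul_coface p q (single x) (single y) (single_degree x) (single_degree y)
  (single_coboundary dx) (single_coboundary dy).
exists (h *~ (-1) ^+ q).
rewrite -(family_sumE _ (fun i => raise (coface K ^~ i) (h *~ (-1) ^+ q))).
rewrite -familyMz -familyB.
move/(congr1 (fun u => u *~ (-1) ^+ q)): e.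
rewrite -[in RHS]mulrzA -expr2 sqrr_sign mulr1z => <-.
apply: (congr1 (fun u : family K (tens M Z W) => u (p + q)%N)).
rewrite mulrz_suml; apply: eq_bigr => i _.
by rewrite raddfMz -!mulrzA mulrC.
Qed.

End FamilyProduct.

(** * Graded commutativity of the cup product *)

Section GradedCommutativity.
Variables (V : category) (MV : sym_monoidal V) (cV : cartesian MV).
Variables (A : abelian_category) (M : sym_monoidal A) (cl : monoidal_closed M).
Variable Sg : strong_sym_monoidal_functor MV M.
Variable X : enriched_category MV.
Variable sums : forall k, coproduct (@bar V MV A M Sg X k).
Local Notation "f ⊠ g" := (tensm M f g) (at level 35, right associativity).
Local Notation id := idm.
Local Notation B k := (coprod (sums k)).
Local Notation face := (face cV sums).

Fact dual_face_face n i j : (i <= j)%N ->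
  dual_map cl (face n.+1 j.+1) ∘ dual_map cl (face n i)
  = dual_map cl (face n.+1 i) ∘ dual_map cl (face n j).
Proof. by move=> ij; rewrite -!dual_mapM face_face_clip. Qed.

Fact dual_face_clip n i : (n < i)%N ->
  dual_map cl (face n i) = dual_map cl (face n n.+1).
Proof. by move=> ni; rewrite face_clip. Qed.

Definition cochain_cofaces : cosemisimplicial A :=
  Cosemisimplicial (cs_ob := fun n => dual cl (B n))
    dual_face_face dual_face_clip.

(** The pointwise product of two cochains of the same degree, dual to the
    coalgebra structure of B in that degree; it is commutative, and the cup
    product is obtained from it by front and back faces. *)
Definition cochain_diag_mul n :
    hom (tens M (dual cl (B n)) (dual cl (B n))) (dual cl (B n)) :=
  dual_map cl (bar_copy cV sums n) ∘ dual_tens cl (B n) (B n).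

Lemma cochain_diag_mul_coface n i :
  cochain_diag_mul n.+1 ∘ (dual_map cl (face n i) ⊠ dual_map cl (face n i))
  = dual_map cl (face n i) ∘ cochain_diag_mul n.
Proof.
rewrite /cochain_diag_mul -compA -dual_tensN !compA -!dual_mapM.
by rewrite bar_copy_face.
Qed.

Lemma cochain_diag_mul_braid n :
  cochain_diag_mul n ∘ braid M _ _ = cochain_diag_mul n.
Proof.
rewrite /cochain_diag_mul -[in RHS](dual_tens_braid cl) !compA -dual_mapM.
by rewrite braid_bar_copy.
Qed.

Lemma cochain_mulE p q :
  cochain_mul sums cl p q
  = cochain_diag_mul (p + q)
    ∘ (dual_map cl (front_map cV sums p q)
         ⊠ dual_map cl (back_map cV sums p q)).
Proof.
rewrite /cochain_diag_mul -compA -dual_tensN compA -dual_mapM.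
by rewrite -comult_front_back.
Qed.

Lemma cobdryE k :
  cobdry (magnitude_cochains cV sums cl) k
  = \sum_(i < k.+2) coface cochain_cofaces k i *~ (-1) ^+ i.
Proof.
rewrite /= /dual_map /magnitude_bdry (raddf_sum (@ihom_map A M cl _ _ _)).
by apply: eq_bigr => i _; rewrite (raddfMz (@ihom_map A M cl _ _ _)).
Qed.

Local Notation K := cochain_cofaces.
Local Notation d0 := (raise (coface K ^~ 0%N)).
Local Notation dl := (raise (fun n => coface K n n.+1)).

Lemma iter_d0_back Z p q (x : family K Z) :
  iter p d0 x (p + q)%N = dual_map cl (back_map cV sums p q) ∘ x q.
Proof.
apply: (@iter_d0E _ K _ p q (fun p q => dual_map cl (back_map cV sums p q))).
  by move=> r; rewrite back_map0 dual_map1.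
by move=> r s; rewrite -back_map_face dual_mapM.
Qed.

Lemma iter_dl_front Z p q (x : family K Z) :
  iter q dl x (p + q)%N = dual_map cl (front_map cV sums p q) ∘ x p.
Proof.
apply: (@iter_dlE _ K _ p q (fun p q => dual_map cl (front_map cV sums p q))).
  by move=> r; rewrite front_map0 dual_deg_cast.
move=> r s; rewrite /= -dual_mapM front_map_face dual_mapM.
by rewrite (dual_deg_cast cl (fun k => B k)) esymK.
Qed.

Lemma cochain_mul_family Z W p q (x : hom Z (K p)) (y : hom W (K q)) :
  cochain_mul sums cl p q ∘ (x ⊠ y)
  = family_mul (K := K) cochain_diag_mul
      (iter q dl (single x)) (iter p d0 (single y)) (p + q)%N.
Proof.
rewrite /family_mul iter_dl_front iter_d0_back !singleE tensmM compA.
by rewrite -cochain_mulE.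
Qed.

Lemma deg_cast_family (Z : A) (x : family K Z) n m (e : n = m) :
  deg_cast K e ∘ x n = x m.
Proof. by case: m / e; rewrite /deg_cast /= comp1m. Qed.

Lemma swapped_cochain_mul_family Z W p q (x : hom Z (K p)) (y : hom W (K q)) :
  deg_cast K (addnC q p) ∘ cochain_mul sums cl q p ∘ (y ⊠ x) ∘ braid M Z W
  = family_mul (K := K) cochain_diag_mul
      (iter q d0 (single x)) (iter p dl (single y)) (p + q)%N.
Proof.
rewrite -(compA (deg_cast _ _)) cochain_mul_family deg_cast_family.
by rewrite /family_mul -compA -braidN compA cochain_diag_mul_braid.
Qed.

Lemma cocycle_family p (H := magnitude_cochains cV sums cl) :
  \sum_(i < p.+2) (coface K p i ∘ kermap (cocycles H p)) *~ (-1) ^+ i = 0.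
Proof.
rewrite -[RHS](comp_kermap (cocycles H p)).
rewrite [X in _ = X ∘ _](cobdryE p) comp_suml.
by apply: eq_bigr => i _; rewrite compzl.
Qed.

(** In degree 0 the sum vanishes, which matches the convention that no
    coboundary arrives there. *)
Lemma family_coboundary Z n (h : family K Z)
    (H := magnitude_cochains cV sums cl) :
  exists h' : hom Z (coch_prev H n),
    \sum_(0 <= i < n.+1) raise (coface K ^~ i) h n *~ (-1) ^+ i
    = cobdry_in H n ∘ h'.
Proof.
case: n => [|n].
  by exists 0; rewrite comp0r big1 // => i _; rewrite /= mul0rz.
exists (h n); rewrite big_mkord [cobdry_in _ _]cobdryE comp_suml.
by apply: eq_bigr => i _; rewrite compzl.
Qed.

Lemma deg_cast_cokermap (H : cochain_complex A) n m (e : n = m) :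
  deg_cast (cohomology H) e ∘ cokermap (cohomology H n)
  = cokermap (cohomology H m) ∘ deg_cast (fun k => cocycles H k) e.
Proof. by case: m / e; rewrite /deg_cast /= comp1m compm1. Qed.

Lemma deg_cast_kermap (H : cochain_complex A) n m (e : n = m) :
  kermap (cocycles H m) ∘ deg_cast (fun k => cocycles H k) e
  = deg_cast H e ∘ kermap (cocycles H n).
Proof. by case: m / e; rewrite /deg_cast /= comp1m compm1. Qed.

End GradedCommutativity.

Theorem theorem5p7
    (V : category) (MV : sym_monoidal V) (cV : cartesian MV)
    (A : abelian_category) (M : sym_monoidal A) (cl : monoidal_closed M)
    (Sg : strong_sym_monoidal_functor MV M) (X : enriched_category MV)
    (sums : forall k : nat, coproduct (@bar V MV A M Sg X k)) :
  graded_commutative (magnitude_cup cV sums cl).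
Proof.
move=> p q; set C := magnitude_cochains cV sums cl.
apply: (@cohomology_mul_uniq _ _ cl C).
rewrite -[LHS]compA braidN [LHS]compA compzl.
rewrite -[X in X ∘ _ = _]compA (cohomology_mulE cl) (cohomology_mulE cl).
rewrite [X in X ∘ _ = _]compA deg_cast_cokermap -!compA -compzr.
apply/eqP; rewrite -subr_eq0 -compBr; apply/eqP.
(* The inclusions of the cocycles are generalized elements killed by the
   coboundary, so the cup-1 identity applies to them. *)
have [h e] := cup1_family (K := cochain_cofaces cV cl sums) cl
  (@cochain_diag_mul_coface _ _ cV _ _ cl _ _ sums)
  (cocycle_family cV cl sums p) (cocycle_family cV cl sums q).
have [h' e'] := family_coboundary (p + q)%N h.
rewrite e' -swapped_cochain_mul_family -cochain_mul_family in e.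
apply: (@cobdry_in_H _ C _ _ h').
rewrite -[RHS]e compBr compzr [X in X - _]compA deg_cast_kermap.
rewrite (cocycles_mulE cl) -[X in X - _]compA [X in _ ∘ X - _]compA.
by rewrite (cocycles_mulE cl) -!compA.
Qed.
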